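(* Let $p,q>0$, put $s=p+q$, and set $$\Psi(p,q)=2s^3(s+1)+pq\bigl(s^3-7s^2-16s-12\bigr).$$ Then $$D_1(\beta_{p,q})=\frac{p^2q^2\,\Psi(p,q)}{s^6(s+1)^3(s+2)^2(s+3)}.$$ Consequently, if $\Psi(p,q)<0$, then $\beta_{p,q}$ is not freely infinitely divisible.
   Context: For $p,q>0$, $\beta_{p,q}$ denotes the beta distribution on $[0,1]$ with density $x^{p-1}(1-x)^{q-1}/B(p,q)$ on $(0,1)$, where $B$ is the Euler beta function. For a probability measure $\mu$ on $\mathbb{R}$ with finite moments $m_n(\mu)=\int x^n\,\mu(\mathrm{d}x)$, the free cumulants $\kappa_n(\mu)$, $n\ge 1$, are determined by $m_n(\mu)=\sum_{\pi\in NC(n)}\prod_{V\in\pi}\kappa_{|V|}(\mu)$ for all $n\geq 1$, where $NC(n)$ is the set of noncrossing partitions of $\{1,\dots,n\}$ and the product is over the blocks $V$ of $\pi$. $D_1(\mu)=\kappa_2(\mu)\kappa_4(\mu)-\kappa_3(\mu)^2$. A probability measure $\mu$ on $\mathbb{R}$ is freely infinitely divisible if for every $n\in\mathbb{N}$, $n\ge1$, there is a probability measure $\mu_n$ on $\mathbb{R}$ such that $\mu$ is the $n$-fold free additive convolution power $\mu_n^{\boxplus n}$. *)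

(* Defs.v *)
From HB Require Import structures.
From mathcomp Require Import all_boot all_order all_algebra.
From mathcomp Require Import all_classical all_reals all_analysis.
From mathcomp Require Import measurable_realfun complex.
From mathcomp Require Import zify ring lra.

Set Implicit Arguments.
Unset Strict Implicit.
Unset Printing Implicit Defensive.

Import Order.TTheory GRing.Theory Num.Theory.
Import numFieldNormedType.Exports.

Local Open Scope ring_scope.

Section free_cumulants.
Context {R : realType}.
Local Notation law := (probability (measurableTypeR R) R).

Definition moment (mu : law) (n : nat) : R := \int[mu]_x (x ^+ n).

(* No a < b < c < d with a, c in one block and b, d in another one. *)
Definition noncrossing (n : nat) (P : {set {set 'I_n}}) : bool :=
  [forall V in P, forall W in P, (V != W) ==>
    ~~ [exists a in V, exists b in W, exists c in V, exists d in W,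
         (a < b < c)%N && (c < d)%N]].

Definition NC (n : nat) : {set {set {set 'I_n}}} :=
  [set P : {set {set 'I_n}} | finset.partition P [set: 'I_n] & noncrossing P].

Definition moment_cumulant (m k : nat -> R) : Prop :=
  forall n, (0 < n)%N -> m n = \sum_(P in NC n) \prod_(V in P) k #|V|.

(* The choice is harmless: a solution exists (moment_cumulant_ex) and its values
   at the positive integers are unique (moment_cumulant_inj); k 0 never occurs,
   as the blocks of a partition are nonempty. *)
Definition free_cumulant (mu : law) : nat -> R :=
  get [set k : nat -> R | moment_cumulant (moment mu) k]%classic.

Let top n : {set {set 'I_n}} := [set [set: 'I_n]].

Let top_NC n : (0 < n)%N -> top n \in NC n.
Proof.
move=> n0; rewrite inE; apply/andP; split.
  rewrite /finset.partition /finset.cover big_set1 eqxx /=; apply/andP; split.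
    apply/finset.trivIsetP => A B; rewrite !inE => /eqP -> /eqP ->.
    by rewrite eqxx.
  by rewrite inE eq_sym -card_gt0 cardsT card_ord.
apply/forall_inP => V; rewrite inE => /eqP ->.
by apply/forall_inP => W; rewrite inE => /eqP ->; rewrite eqxx.
Qed.

Let NC_block n P (V : {set 'I_n}) :
  P \in NC n -> P != top n -> V \in P -> (#|V| < n)%N.
Proof.
rewrite inE => /andP[partP _] Ptop VP.
rewrite ltn_neqAle -[X in (_ <= X)%N]card_ord max_card andbT.
apply: contra Ptop => /eqP cV.
have VT : V = [set: 'I_n].
  by apply/eqP; rewrite eqEcard finset.subsetT cardsT card_ord cV leqnn.
apply/eqP/finset.setP => W; rewrite inE; apply/idP/eqP => [WP|->]; last by rewrite -VT.
apply/eqP; apply: contraT => WV.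
have /and3P[_ /finset.trivIsetP tr P0] := partP.
rewrite -VT in WV.
have := tr _ _ WP VP WV; rewrite VT -finset.setI_eq0 finset.setIT => /eqP W0.
by move: P0; rewrite -W0 WP.
Qed.

Let moment_cumulantE n (k : nat -> R) : (0 < n)%N ->
  \sum_(P in NC n) \prod_(V in P) k #|V| =
  k n + \sum_(P in NC n | P != top n) \prod_(V in P) k #|V|.
Proof.
move=> n0; rewrite (bigD1 (top n)) ?top_NC//= big_set1 cardsT card_ord.
by [].
Qed.

Lemma moment_cumulant_inj (m k l : nat -> R) :
  moment_cumulant m k -> moment_cumulant m l ->
  forall n, (0 < n)%N -> k n = l n.
Proof.
move=> mk ml n; have [N] := ubnP n; elim: N n => // N IH n nN n0.
have := mk n n0; rewrite (ml n n0) !moment_cumulantE// => /esym.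
set S := \sum_(P in _ | _) _; set S' := \sum_(P in _ | _) _.
suff -> : S = S' by move/addIr.
apply: eq_bigr => P /andP[PNC PT]; apply: eq_bigr => V VP.
apply: IH; first exact: leq_trans (NC_block PNC PT VP) _.
move: PNC; rewrite inE => /andP[/and3P[_ _ P0] _].
by rewrite card_gt0; apply: contraNneq P0 => <-.
Qed.

(* Solves the moment-cumulant relations one order at a time; only used to prove
   that they have a solution. *)
Fixpoint cumulant_upto (m : nat -> R) (n : nat) : nat -> R :=
  if n is n'.+1 then fun j =>
    if j == n'.+1 then m n'.+1 - \sum_(P in NC n'.+1 | P != top n'.+1)
                                   \prod_(V in P) cumulant_upto m n' #|V|
    else cumulant_upto m n' j
  else fun=> 0.

Lemma moment_cumulant_ex (m : nat -> R) : exists k, moment_cumulant m k.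
Proof.
exists (fun n => cumulant_upto m n n) => n n0.
have stab j N : (j <= N)%N -> cumulant_upto m N j = cumulant_upto m j j.
  elim: N => [|N IH]; first by rewrite leqn0 => /eqP ->.
  rewrite leq_eqVlt => /predU1P[->//|jN].
  by rewrite [LHS]/= ltn_eqF// IH.
rewrite (moment_cumulantE (fun j => cumulant_upto m j j))//.
case: n n0 => // n _.
rewrite {1}/cumulant_upto -/cumulant_upto eqxx.
rewrite (eq_bigr (fun P : {set {set _}} =>
  \prod_(V in P) cumulant_upto m #|V| #|V|)) ?subrK//.
move=> P /andP[PNC PT]; apply: eq_bigr => V VP.
by rewrite stab//; exact: (NC_block PNC PT VP).
Qed.

Lemma free_cumulantP (mu : law) :
  moment_cumulant (moment mu) (free_cumulant mu).
Proof.
have [k mk] := moment_cumulant_ex (moment mu).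
exact: (@getPex _ [set k | moment_cumulant (moment mu) k]%classic (ex_intro _ k mk)).
Qed.

Definition D1 (mu : law) : R :=
  free_cumulant mu 2 * free_cumulant mu 4 - free_cumulant mu 3 ^+ 2.

End free_cumulants.

Local Open Scope classical_set_scope.

Section beta.
Context {R : realType}.
Local Notation leb := (@lebesgue_measure R).

Definition beta_kernel (p q x : R) : R := x `^ (p - 1) * (1 - x) `^ (q - 1).

Definition euler_beta (p q : R) : R :=
  \int[leb]_(x in `]0, 1[) beta_kernel p q x.

Definition beta_density (p q x : R) : R :=
  if 0 < x < 1 then beta_kernel p q x / euler_beta p q else 0.

(* Not the beta_prob of the library, whose parameters are natural numbers. The
   proofs of positivity are needed for the probability instance below. *)
Definition beta_law (p q : R) (hp : 0 < p) (hq : 0 < q) :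
    set (measurableTypeR R) -> \bar R :=
  fun U => (\int[leb]_(x in U) (beta_density p q x)%:E)%E.

Let kernel_ge0 (p q x : R) : 0 <= beta_kernel p q x.
Proof. by rewrite mulr_ge0// powR_ge0. Qed.

Let measurable_kernel (p q : R) : measurable_fun [set: R] (beta_kernel p q).
Proof.
apply: measurable_funM; first exact: measurable_powR.
apply: (measurableT_comp (measurable_powR (q - 1))).
exact: measurable_funB.
Qed.

Let powR_bounds (x r : R) : 4^-1 <= x <= 1 ->
  expR (- (`|r| * ln 4)) <= x `^ r <= expR (`|r| * ln 4).
Proof.
move=> /andP[x4 x1]; have x0 : 0 < x by apply: lt_le_trans x4.
rewrite /powR gt_eqF// !ler_expR -ler_norml normrM ler_wpM2l//.
rewrite ler0_norm ?ln_le0// lerNl -lnV ?posrE//.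
by rewrite ler_ln ?posrE.
Qed.

Let primitive (p q x : R) : R := x `^ p / p - (1 - x) `^ q / q.

Let dom (p q x : R) : R := x `^ (p - 1) + (1 - x) `^ (q - 1).

Let K (p q : R) : R := expR ((`|p - 1| + `|q - 1|) * ln 4).

Let kernel_dom (p q x : R) : 0 < x < 1 -> beta_kernel p q x <= K p q * dom p q x.
Proof.
move=> /andP[x0 x1].
have ln4 : 0 <= ln (4 : R) by rewrite ln_ge0 ?ler1n.
rewrite /beta_kernel /dom mulrDr.
have [xh|xh] := leP x 2^-1.
  rewrite [leLHS]mulrC; apply: (@le_trans _ _ (K p q * x `^ (p - 1))).
    apply: ler_wpM2r; first exact: powR_ge0.
    have /andP[_] : expR (- (`|q - 1| * ln 4)) <= (1 - x) `^ (q - 1)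
        <= expR (`|q - 1| * ln 4) by apply: powR_bounds; lra.
    move=> /le_trans; apply; rewrite ler_expR ler_wpM2r//.
    by rewrite lerDr.
  by rewrite lerDl mulr_ge0 ?expR_ge0 ?powR_ge0.
apply: (@le_trans _ _ (K p q * (1 - x) `^ (q - 1))).
  apply: ler_wpM2r; first exact: powR_ge0.
  have /andP[_] : expR (- (`|p - 1| * ln 4)) <= x `^ (p - 1)
      <= expR (`|p - 1| * ln 4) by apply: powR_bounds; lra.
  move=> /le_trans; apply; rewrite ler_expR ler_wpM2r//.
  by rewrite lerDl.
by rewrite lerDr mulr_ge0 ?expR_ge0 ?powR_ge0.
Qed.

Let kernel_lbound (p q x : R) : 4^-1 < x < 2^-1 -> (K p q)^-1 <= beta_kernel p q x.
Proof.
move=> /andP[x4 x2].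
have /andP[A _] : expR (- (`|p - 1| * ln 4)) <= x `^ (p - 1)
      <= expR (`|p - 1| * ln 4) by apply: powR_bounds; lra.
have /andP[B _] : expR (- (`|q - 1| * ln 4)) <= (1 - x) `^ (q - 1)
      <= expR (`|q - 1| * ln 4) by apply: powR_bounds; lra.
rewrite /K -expRN mulrDl opprD expRD.
by apply: ler_pM => //; exact: expR_ge0.
Qed.

Let is_derive_powR (r x : R) : r != 0 -> 0 < x ->
  is_derive x 1 (fun y : R => y `^ r / r) (x `^ (r - 1)).
Proof.
move=> r0 x0.
have xI : x \in `]0, +oo[%R by rewrite in_itv/= x0.
have D : is_derive x 1 (fun y : R => y `^ r) (r * x `^ (r - 1)).
  apply: DeriveDef; first exact: derivable_powR.
  by rewrite -derive1E powR_derive1.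
have -> : (fun y : R => y `^ r / r) = r^-1 \*: (fun y : R => y `^ r).
  by apply/funext => y; rewrite /= mulrC.
apply: (is_derive_eq (is_deriveZ r^-1 D)).
by rewrite /GRing.scale/= mulKf.
Qed.

Let is_derive_primitive (p q x : R) : 0 < p -> 0 < q -> 0 < x < 1 ->
  is_derive x 1 (primitive p q) (dom p q x).
Proof.
move=> p0 q0 /andP[x0 x1].
have D1 := is_derive_powR (lt0r_neq0 p0) x0.
have x1' : 0 < 1 - x by rewrite subr_gt0.
have D2 := is_derive_powR (lt0r_neq0 q0) x1'.
have D3 : is_derive x 1 (fun y : R => 1 - y) (- 1).
  have -> : (fun y : R => 1 - y) = cst 1 - id by [].
  by apply: is_derive_eq; rewrite sub0r.
have D4 := @is_derive1_comp R (fun y : R => y `^ q / q) (fun y => 1 - y) x _ _ D2 D3.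
have D5 := is_deriveB D1 D4.
by apply: (is_derive_eq D5); rewrite mulrN1 opprK.
Qed.


Let continuous_powR (r x : R) : 0 < x -> {for x, continuous (fun y : R => y `^ r)}.
Proof.
move=> x0; apply: differentiable_continuous; apply/derivable1_diffP.
by apply: derivable_powR; rewrite in_itv/= x0.
Qed.

Let continuous_dom (p q x : R) : 0 < x < 1 -> {for x, continuous (dom p q)}.
Proof.
move=> /andP[x0 x1]; apply: cvgD; first exact: continuous_powR.
have C1 : 1 - y @[y --> x] --> 1 - x by apply: cvgB; [exact: cvg_cst|exact: cvg_id].
have x1' : 0 < 1 - x by rewrite subr_gt0.
exact: (cvg_comp _ _ C1 (@continuous_powR (q - 1) (1 - x) x1')).
Qed.

Let integral_dom (p q a b : R) : 0 < p -> 0 < q -> 0 < a -> a < b -> b < 1 ->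
  (\int[leb]_(x in `[a, b]) (dom p q x)%:E <= (p^-1 + q^-1)%:E)%E.
Proof.
move=> p0 q0 a0 ab b1.
have in01 x : a <= x <= b -> 0 < x < 1.
  by move=> /andP[ax xb]; rewrite (lt_le_trans a0 ax) (le_lt_trans xb b1).
have cF x : a <= x <= b -> {for x, continuous (primitive p q)}.
  move=> /in01 x01; apply: differentiable_continuous; apply/derivable1_diffP.
  have D := is_derive_primitive p0 q0 x01; exact: ex_derive.
rewrite (@continuous_FTC2 _ _ (primitive p q))//.
- rewrite -EFinB lee_fin /primitive.
  have pow01 (r y : R) : 0 < r -> 0 <= y <= 1 -> 0 <= y `^ r / r <= r^-1.
    move=> r0 /andP[y0 y1]; rewrite divr_ge0 ?powR_ge0 ?(ltW r0)//=.
    rewrite ler_piMl ?invr_ge0 ?(ltW r0)//.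
    apply: (@le_trans _ _ (1 `^ r)); last by rewrite powR1.
    by apply: ge0_ler_powR; rewrite ?nnegrE// ltW.
  have /andP[A1 A2] : 0 <= b `^ p / p <= p^-1 by apply: pow01; lra.
  have /andP[B1 B2] : 0 <= a `^ p / p <= p^-1 by apply: pow01; lra.
  have /andP[C1 C2] : 0 <= (1 - b) `^ q / q <= q^-1 by apply: pow01; lra.
  have /andP[D1 D2] : 0 <= (1 - a) `^ q / q <= q^-1 by apply: pow01; lra.
  lra.
- apply/continuous_in_subspaceT => x; rewrite inE/= in_itv/= => /in01.
  exact: continuous_dom.
- split.
  + move=> x; rewrite in_itv/= => /andP[ax xb].
    have x01 : 0 < x < 1 by apply: in01; rewrite !ltW.
    have D := is_derive_primitive p0 q0 x01; exact: ex_derive.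
  + by apply: cvg_at_right_filter; apply: cF; rewrite lexx ltW.
  + by apply: cvg_at_left_filter; apply: cF; rewrite lexx ltW.
- move=> x; rewrite in_itv/= => /andP[ax xb].
  have x01 : 0 < x < 1 by apply: in01; rewrite !ltW.
  have D := is_derive_primitive p0 q0 x01.
  by rewrite derive1E; exact: derive_val.
Qed.

Let measurable_dom (p q : R) : measurable_fun [set: R] (dom p q).
Proof.
apply: measurable_funD; first exact: measurable_powR.
apply: (measurableT_comp (measurable_powR (q - 1))).
exact: measurable_funB.
Qed.

Let dom_ge0 (p q x : R) : 0 <= dom p q x.
Proof. by rewrite addr_ge0// powR_ge0. Qed.

Let integral_dom01 (p q : R) : 0 < p -> 0 < q ->
  (\int[leb]_(x in `]0%R, 1%R[) (dom p q x)%:E <= (p^-1 + q^-1)%:E)%E.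
Proof.
move=> p0 q0.
pose F n : set R := `[n.+3%:R^-1, 1 - n.+3%:R^-1].
have n3 n : n.+3%:R^-1 <= 3^-1 :> R by rewrite lef_pV2 ?posrE// ler_nat.
have FE : \bigcup_n F n = `]0%R, 1%R[.
  apply/seteqP; split => x.
    move=> [n _]; rewrite /F /= !in_itv/= => /andP[A B].
    have e0 : 0 < n.+3%:R^-1 :> R by rewrite invr_gt0.
    by apply/andP; split; [exact: lt_le_trans A|apply: le_lt_trans B _; rewrite gtrBl].
  rewrite /= in_itv/= => /andP[x0 x1].
  have e0 : 0 < Num.min x (1 - x) by rewrite lt_min x0 subr_gt0.
  have [n /ltW] : exists n, n.+1%:R^-1 < Num.min x (1 - x).
    have [n _ H] := near_infty_natSinv_lt (PosNum e0).
    by exists n; exact: (H n (leqnn n)).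
  rewrite le_min => /andP[A B].
  exists n => //; rewrite /F /= in_itv/=.
  have : n.+3%:R^-1 <= n.+1%:R^-1 :> R by rewrite lef_pV2 ?posrE ?ltr0n ?ler_nat//; lia.
  move: (n.+3%:R^-1) (n.+1%:R^-1) A B => a b A B ab.
  by apply/andP; split; lra.
have H : (\int[leb]_(x in F i) (dom p q x)%:E @[i --> \oo] -->
    \int[leb]_(x in \bigcup_i F i) (dom p q x)%:E)%E.
  apply: ge0_nondecreasing_set_cvg_integral => //.
  - move=> m n mn; apply/subsetPset => x; rewrite /F /= !in_itv/=.
    have : n.+3%:R^-1 <= m.+3%:R^-1 :> R.
      by rewrite lef_pV2 ?posrE// ler_nat !ltnS.
    move: (n.+3%:R^-1) (m.+3%:R^-1) => a b ab /andP[A B].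
    by apply/andP; split; lra.
  - by move=> n; exact: measurable_itv.
  - by move=> n; apply/measurable_EFinP/measurable_funTS; exact: measurable_dom.
  - by move=> n x _; rewrite lee_fin dom_ge0.
rewrite -FE -(cvg_lim _ H)//; apply: lime_le; first by apply/cvg_ex; eexists; exact: H.
apply: nearW => n; apply: integral_dom => //.
by have := n3 n; move: (n.+3%:R^-1) => a; lra.

Qed.

Let m01 : measurable (`]0%R, 1%R[ : set R).
Proof. exact: measurable_itv. Qed.

Let integrable_kernel (p q : R) : 0 < p -> 0 < q ->
  leb.-integrable `]0%R, 1%R[ (EFin \o beta_kernel p q).
Proof.
move=> p0 q0; apply/integrableP; split.
  by apply/measurable_EFinP/measurable_funTS; exact: measurable_kernel.
apply: (@le_lt_trans _ _
    (\int[leb]_(x in `]0%R, 1%R[) ((K p q)%:E * (dom p q x)%:E))%E).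
  apply: ge0_le_integral => //=.
  - by do 2 apply: measurableT_comp => //; apply: measurable_funTS; exact: measurable_kernel.
  - apply/measurable_funeM.
    by apply/measurable_EFinP/measurable_funTS; exact: measurable_dom.
  - move=> x; rewrite in_itv/= => x01; rewrite -EFinM lee_fin.
    by rewrite ger0_norm ?kernel_ge0// kernel_dom.
rewrite ge0_integralZl//=.
- apply: (@le_lt_trans _ _ ((K p q)%:E * (p^-1 + q^-1)%:E)%E); last first.
    by rewrite -EFinM ltry.
  by apply: lee_wpmul2l; [rewrite lee_fin expR_ge0|exact: integral_dom01].
- by apply/measurable_EFinP/measurable_funTS; exact: measurable_dom.
- by move=> x _; rewrite lee_fin dom_ge0.
- by rewrite lee_fin expR_ge0.
Qed.

Lemma EFin_euler_beta (p q : R) : 0 < p -> 0 < q ->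
  (\int[leb]_(x in `]0%R, 1%R[) (beta_kernel p q x)%:E = (euler_beta p q)%:E)%E.
Proof.
move=> p0 q0; rewrite /euler_beta /Rintegral fineK//.
exact/integrable_fin_num/integrable_kernel.
Qed.

Lemma euler_beta_gt0 (p q : R) : 0 < p -> 0 < q -> 0 < euler_beta p q.
Proof.
move=> p0 q0; rewrite -lte_fin -EFin_euler_beta//.
have mS : measurable (`]4^-1, 2^-1[ : set R) by exact: measurable_itv.
apply: (@lt_le_trans _ _
    (\int[leb]_(x in `](4^-1)%R, (2^-1)%R[) ((K p q)^-1)%:E)%E).
  rewrite integral_cst//= lebesgue_measure_itv/= lte_fin.
  have -> : (4^-1 < 2^-1 :> R) by lra.
  rewrite -EFinB -EFinM lte_fin mulr_gt0 ?invr_gt0 ?expR_gt0//; lra.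
apply: (@le_trans _ _
    (\int[leb]_(x in `](4^-1)%R, (2^-1)%R[) (beta_kernel p q x)%:E)%E).
  apply: ge0_le_integral => //=.
  - by move=> x _; rewrite lee_fin invr_ge0 expR_ge0.
  - by apply/measurable_EFinP/measurable_funTS; exact: measurable_kernel.
  - by move=> x; rewrite in_itv/= => ?; rewrite lee_fin kernel_lbound.
apply: ge0_subset_integral => //=.
- by apply/measurable_EFinP/measurable_funTS; exact: measurable_kernel.
- by move=> x _; rewrite lee_fin.
- by move=> x; rewrite /= !in_itv/= => /andP[A B]; apply/andP; split; lra.
Qed.

Lemma beta_density_ge0 (p q x : R) : 0 < p -> 0 < q -> 0 <= beta_density p q x.
Proof.
move=> p0 q0; rewrite /beta_density; case: ifPn => // _.
by rewrite divr_ge0// ltW// euler_beta_gt0.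
Qed.

Lemma measurable_beta_density (p q : R) : measurable_fun setT (beta_density p q).
Proof.
rewrite /beta_density; apply: measurable_fun_if => //=.
- by apply: measurable_and => //; exact: measurable_fun_ltr.
- by apply/measurable_funTS/measurable_funM => //; exact: measurable_kernel.
Qed.

Variables (p q : R) (hp : 0 < p) (hq : 0 < q).

Let beta0 : beta_law hp hq set0 = 0.
Proof. by rewrite /beta_law integral_set0. Qed.

Let beta_ge0 U : (0 <= beta_law hp hq U)%E.
Proof. by apply: integral_ge0 => x _; rewrite lee_fin beta_density_ge0. Qed.

Let beta_sigma_additive : semi_sigma_additive (beta_law hp hq).
Proof.
move=> /= F mF tF mUF; rewrite /beta_law; apply: cvg_toP.
  apply: ereal_nondecreasing_is_cvgn => m n mn.
  apply: lee_sum_nneg_natr => // k _ _.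
  by apply: integral_ge0 => /= x Fkx; rewrite lee_fin beta_density_ge0.
rewrite ge0_integral_bigcup//=.
- by apply/measurable_EFinP/measurable_funTS; exact: measurable_beta_density.
- by move=> x _; rewrite lee_fin beta_density_ge0.
Qed.

HB.instance Definition _ := isMeasure.Build _ _ _ (beta_law hp hq)
  beta0 beta_ge0 beta_sigma_additive.

Let beta_setT : beta_law hp hq [set: _] = 1%:E.
Proof.
rewrite /beta_law.
transitivity (\int[leb]_(x in `]0%R, 1%R[)
    ((beta_kernel p q x)%:E * ((euler_beta p q)^-1)%:E))%E.
  rewrite [RHS]integral_mkcond/=; apply: eq_integral => x _.
  rewrite patchE /beta_density mem_setE in_itv/=.
  by case: ifPn => //; rewrite EFinM.
rewrite ge0_integralZr//=.
- by rewrite EFin_euler_beta// -EFinM divff// gt_eqF// euler_beta_gt0.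
- by apply/measurable_EFinP/measurable_funTS; exact: measurable_kernel.
- by move=> x _; rewrite lee_fin.
- by rewrite lee_fin invr_ge0 ltW// euler_beta_gt0.
Qed.

HB.instance Definition _ := @Measure_isProbability.Build _ _ R
  (beta_law hp hq) beta_setT.

End beta.

Definition Psi {R : realType} (p q : R) : R :=
  let s := p + q in
  2 * s ^+ 3 * (s + 1) + p * q * (s ^+ 3 - 7 * s ^+ 2 - 16 * s - 12).

(* Free additive convolution of arbitrary probability measures on the line, after
   Bercovici and Voiculescu: the Voiculescu transform of mu is
   phi_mu z = F_mu^{-1} z - z, where F_mu^{-1} is a right inverse of the
   reciprocal Cauchy transform F_mu on some truncated cone, and mu [+] nu is the
   probability measure whose Voiculescu transform is phi_mu + phi_nu. *)
Section free_convolution.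
Context {R : realType}.
Local Open Scope complex_scope.
Local Notation C := R[i].
Local Notation Re := complex.Re.
Local Notation Im := complex.Im.
Local Notation law := (probability (measurableTypeR R) R).

(* G_mu z = \int mu(dt) / (z - t), integrated componentwise; it is only used for
   z in the open upper half-plane, where the integrand is bounded. *)
Definition cauchy_transform (mu : law) (z : C) : C :=
  (\int[mu]_t Re ((z - t%:C)^-1)) +i* (\int[mu]_t Im ((z - t%:C)^-1)).

Definition reciprocal_cauchy_transform (mu : law) (z : C) : C :=
  (cauchy_transform mu z)^-1.

Definition truncated_cone (a b : R) : set C :=
  [set z | `|Re z| < a * Im z /\ b < Im z].

(* F_mu need not be injective on the upper half-plane. Holomorphy together with
   phi z = o(z) at infinity in the cone selects the right inverse z + phi z, which
   makes phi unique on the cone. The constants M%:C and e%:C are there because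
   the norm of R[i] is R[i]-valued. *)
Definition is_voiculescu_transform (a b : R) (mu : law) (phi : C -> C) : Prop :=
  (forall z, truncated_cone a b z ->
     [/\ derivable (phi : C^o -> C^o) z 1,
         0 < Im (z + phi z)
       & reciprocal_cauchy_transform mu (z + phi z) = z])
  /\ (forall e : R, 0 < e -> exists M : R, forall z, truncated_cone a b z ->
        M%:C < `|z| -> `|phi z| <= e%:C * `|z|).

Definition is_free_convolution (mu nu rho : law) : Prop :=
  exists (a b : R) (phi psi : C -> C),
    [/\ 0 < a /\ 0 < b, is_voiculescu_transform a b mu phi,
        is_voiculescu_transform a b nu psi
      & is_voiculescu_transform a b rho (fun z => phi z + psi z)].

(* is_free_power mu n rho: rho is the n-fold free convolution power of mu, n > 0.
   Laws are compared on Borel sets, as a measure is a function on all sets. *)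
Inductive is_free_power (mu : law) : nat -> law -> Prop :=
| free_power1 (rho : law) :
    (forall A : set R, measurable (A : set (measurableTypeR R)) ->
      rho A = mu A) ->
    is_free_power mu 1 rho
| free_powerS (n : nat) (sigma rho : law) :
    is_free_power mu n sigma -> is_free_convolution sigma mu rho ->
    is_free_power mu n.+1 rho.

Definition freely_infinitely_divisible (mu : law) : Prop :=
  forall n, (0 < n)%N -> exists mu_n : law, is_free_power mu_n n mu.

End free_convolution.

(* Main.v *)
(** Let G be the Cauchy transform of a law and let phi be its Voiculescu
transform, so that G (z + phi z) = 1 / z.  Everything happens on the imaginary
axis z = iy, y -> +oo, where the right inverse z + phi z is already determined
by phi z = o(z); hence phi_mu = n phi_nu whenever mu is the n-fold free power of
nu.

The functions h_z t = z / (z + phi_nu z - t) - 1 have mean 0 under nu, and by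
partial fractions their inner products are rational expressions in z and
phi_nu z.  Positivity of the Gram determinant of h_{iy} and h_{2iy} is thus an
inequality for phi_mu / n.  Since mu has bounded support, phi_mu z = kappa_1 +
kappa_2 / z + kappa_3 / z^2 + kappa_4 / z^3 + O(z^-4), and the leading term of
the inequality as y -> +oo is kappa_2 (kappa_4 + kappa_2^2 / n) >= kappa_3^2.
Letting n -> oo gives D_1 >= 0.  This way nothing has to be known about the
support or the moments of nu. *)

Require Import Defs.
From mathcomp Require Import all_boot all_order all_algebra.
From mathcomp Require Import all_classical all_reals all_analysis.
From mathcomp Require Import measurable_realfun complex.
From mathcomp Require Import zify ring lra.

Set Implicit Arguments.
Unset Strict Implicit.
Unset Printing Implicit Defensive.

Import Order.TTheory GRing.Theory Num.Theory.
Import numFieldNormedType.Exports.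

Local Open Scope ring_scope.

(** * Moments and free cumulants of order at most four *)

(** The limiting inequality is a Hankel inequality in disguise. If nu had moments, its free
    cumulants would be kappa_k / n, and the determinant of its moment matrix (m_{i+j}), 0 <= i, j <=
    2, would be n^-2 times kappa_2 (kappa_4 + kappa_2^2 / n) - kappa_3^2. The definition of free
    powers gives no control of the tails of nu, so bounded resolvents stand in for polynomials.
    Formally h_z is (t - mean) / z plus a term of order z^-2 that is quadratic in t: two points are
    needed to span both directions. The choice of 2iy as second point is arbitrary and only fixes a
    factor 9/8 in the limit. The first-order parts of the two functions are parallel, so the leading
    orders of the Gram determinant cancel; this is why mu has to be expanded as far as kappa_4, with
    a controlled remainder. *)

Section noncrossing_tables.
Local Open Scope nat_scope.

(** Finite sets over ['I_n] do not evaluate, so partitions are replaced by relations on [nat] tested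
    by loops over [iota 0 n]; on a concrete table this reduces to a Boolean. The middle test is
    symmetry and transitivity at once, in the form of [equivalence_rel]. *)
Definition nc_table (n : nat) (t : rel nat) : bool :=
  let s := iota 0 n in
  [&& all (fun i => t i i) s,
      all (fun i => all (fun j => all (fun l => t i j ==> (t i l == t j l)) s) s) s
    & all (fun a => all (fun b => all (fun c => all (fun d =>
        [&& a < b, b < c, c < d, t a c & t b d] ==> t a b) s) s) s) s].

Definition same_block n (P : {set {set 'I_n}}) : rel 'I_n :=
  fun i j => j \in finset.pblock P i.

Lemma all_iotaP n (p : pred nat) :
  reflect (forall i : 'I_n, p i) (all p (iota 0 n)).
Proof.
apply: (iffP allP) => [H i|H i]; first by apply: H; rewrite mem_iota add0n ltn_ord.
by rewrite mem_iota add0n => /andP[_ ni]; exact: (H (Ordinal ni)).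
Qed.

Lemma nc_tableP n (t : rel nat) :
  reflect ({in [set: 'I_n] & &, equivalence_rel (fun i j : 'I_n => t i j)} /\
           forall a b c d : 'I_n, a < b -> b < c -> c < d -> t a c -> t b d -> t a b)
          (nc_table n t).
Proof.
apply: (iffP and3P) => [[/all_iotaP H1 /all_iotaP H2 /all_iotaP H3]|[H1 H2]].
  split.
    move=> i j l _ _ _; split; first exact: H1.
    have /all_iotaP/(_ j)/all_iotaP/(_ l)/implyP H := H2 i.
    by move=> /H/eqP.
  move=> a b c d ab bc cd ac bd.
  have /all_iotaP/(_ b)/all_iotaP/(_ c)/all_iotaP/(_ d)/implyP := H3 a.
  by apply; rewrite ab bc cd ac bd.
split; apply/all_iotaP => i.
- by have [] := H1 i i i (finset.in_setT _) (finset.in_setT _) (finset.in_setT _).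
- apply/all_iotaP => j; apply/all_iotaP => l; apply/implyP => ij; apply/eqP.
  by have [_] := H1 i j l (finset.in_setT _) (finset.in_setT _) (finset.in_setT _); exact.
- apply/all_iotaP => b; apply/all_iotaP => c; apply/all_iotaP => d.
  by apply/implyP => /and5P[]; exact: H2.
Qed.

Lemma same_block_equivalence n (P : {set {set 'I_n}}) :
  finset.partition P [set: 'I_n] ->
  {in [set: 'I_n] & &, equivalence_rel (same_block P)}.
Proof. by move=> PP; apply: finset.pblock_equivalence. Qed.

(** A crossing needs two different blocks, so by contraposition a crossing pattern forces the blocks
    of a and b to coincide. In this form only four points are quantified, which a table can test. *)
Lemma noncrossingP n (P : {set {set 'I_n}}) : finset.partition P [set: 'I_n] ->
  reflect (forall a b c d : 'I_n, a < b -> b < c -> c < d ->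
             same_block P a c -> same_block P b d -> same_block P a b)
          (noncrossing P).
Proof.
move=> PP; have /and3P[/eqP covP tr _] := PP.
have cov (i : 'I_n) : i \in finset.cover P by rewrite covP finset.in_setT.
have PV V (i : 'I_n) : V \in P -> i \in V -> finset.pblock P i = V.
  exact: finset.def_pblock.
apply: (iffP forall_inP) => [H a b c d ab bc cd ac bd|H V VP].
  have := H _ (finset.pblock_mem (cov a)).
  move=> /forall_inP/(_ _ (finset.pblock_mem (cov b)))/implyP.
  have [e _|ne /(_ isT)/negP[]] := eqVneq (finset.pblock P a) (finset.pblock P b).
    by rewrite /same_block e finset.mem_pblock cov.
  apply/exists_inP; exists a; first by rewrite finset.mem_pblock cov.
  apply/exists_inP; exists b; first by rewrite finset.mem_pblock cov.
  apply/exists_inP; exists c => //.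
  apply/exists_inP; exists d => //.
  by rewrite ab bc cd.
apply/forall_inP => W WP; apply/implyP; apply: contra.
move=> /exists_inP[a aV]/exists_inP[b bW]/exists_inP[c cV]/exists_inP[d dW].
move=> /andP[/andP[ab bc] cd].
have : same_block P a b.
  apply: (H a b c d) => //; rewrite /same_block.
    by rewrite (PV V).
  by rewrite (PV W).
rewrite /same_block (PV V)// => bV.
by rewrite -(PV V b) // (PV W b).
Qed.

Lemma same_block_partition n (r : rel 'I_n) :
  {in [set: 'I_n] & &, equivalence_rel r} ->
  same_block (finset.equivalence_partition r [set: 'I_n]) =2 r.
Proof.
move=> er i j; rewrite /same_block finset.pblock_equivalence_partition//.
Qed.

End noncrossing_tables.

(** * Sums over noncrossing partitions as sums over explicit tables *)

Section sum_NC.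
Context {R : comNzRingType}.

(* Each block is counted once, at its least element. *)
Lemma prod_blocks n (P : {set {set 'I_n}}) (k : nat -> R) :
  finset.partition P [set: 'I_n] ->
  \prod_(V in P) k #|V| =
  \prod_(i < n | ~~ [exists j : 'I_n, (j < i)%N && same_block P i j])
    k (\sum_(j < n) same_block P i j)%N.
Proof.
move=> PP; have /and3P[/eqP covP tr P0] := PP.
have cov (i : 'I_n) : i \in finset.cover P by rewrite covP finset.in_setT.
have PV V (i : 'I_n) : V \in P -> i \in V -> finset.pblock P i = V.
  exact: finset.def_pblock.
pose A := [set i : 'I_n | ~~ [exists j : 'I_n, (j < i)%N && same_block P i j]]%SET.
have PE : P = [set finset.pblock P i | i in A]%SET.
  apply/finset.setP => V; apply/idP/finset.imsetP => [VP|[i _ ->]]; last first.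
    exact: finset.pblock_mem.
  have [i iV] : exists i, i \in V.
    by apply/set0Pn; apply: contraNneq P0 => <-.
  case: (@arg_minnP _ i (mem V) (fun i => val i) iV) => j jV jmin.
  exists j; last by rewrite (PV V).
  rewrite inE; apply/negP => /existsP[l /andP[lj]]; rewrite /same_block (PV V)// => /jmin.
  by rewrite leqNgt lj.
rewrite {1}PE big_imset/=; last first.
  move=> i j; rewrite !inE => /negP iA /negP jA e.
  apply: ord_inj; apply/eqP; rewrite eqn_leq (leqNgt i j) (leqNgt j i).
  apply/andP; split; apply/negP => ij.
    by apply: iA; apply/existsP; exists j; rewrite ij /same_block e finset.mem_pblock cov.
  by apply: jA; apply/existsP; exists i; rewrite ij /same_block -e finset.mem_pblock cov.
apply: eq_big => [i|i _]; first by rewrite inE.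
by rewrite -sum1_card big_mkcond/=; congr k; apply: eq_bigr => j _; rewrite /same_block; case: ifP.
Qed.

(** The bijection behind the reindexing sends a code b to the classes of [tb b], and a partition to
    the code that [bt] reads off its relation. The first hypothesis recovers a code from its table;
    the second says that coding an equivalence and decoding it again changes nothing below n. For
    concrete n the hypotheses are settled by evaluation or a short case analysis. *)
Lemma sum_NC n (k : nat -> R) (B : finType) (tb : B -> rel nat)
    (bt : rel nat -> B) (L : seq B) :
  (forall b (r : rel nat), {in gtn n &, tb b =2 r} -> bt r = b) ->
  (forall r : rel nat, {in [set: 'I_n] & &, equivalence_rel (fun i j : 'I_n => r i j)} ->
     {in gtn n &, tb (bt r) =2 r}) ->
  uniq L -> (forall b, (b \in L) = nc_table n (tb b)) ->
  \sum_(P in NC n) \prod_(V in P) k #|V| =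
  \sum_(b <- L) \prod_(0 <= i < n | ~~ has (tb b i) (iota 0 i))
     k (\sum_(0 <= j < n) tb b i j)%N.
Proof.
move=> tbK btK uL LE.
(* [bt] expects a relation on [nat]: [same_block P] is extended by false outside {0, ..., n-1}. *)
pose rP (P : {set {set 'I_n}}) : rel nat := fun i j =>
  [exists a : 'I_n, [exists b : 'I_n, [&& val a == i, val b == j & same_block P a b]]].
have rPE P (i j : 'I_n) : rP P i j = same_block P i j.
  apply/existsP/idP => [[a /existsP[b /and3P[/eqP/val_inj-> /eqP/val_inj->]]]//|ij].
  by exists i; apply/existsP; exists j; rewrite !eqxx.
have rP_eq P : finset.partition P [set: 'I_n] ->
    {in [set: 'I_n] & &, equivalence_rel (fun i j : 'I_n => rP P i j)}.
  move=> /same_block_equivalence e i j l iT jT lT; rewrite !rPE.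
  exact: e.
pose E (b : B) := finset.equivalence_partition (fun i j : 'I_n => tb b i j) [set: 'I_n].
have tbE P : finset.partition P [set: 'I_n] ->
    forall i j : 'I_n, tb (bt (rP P)) i j = same_block P i j.
  by move=> PP i j; rewrite btK ?rPE ?inE//; exact: rP_eq.
rewrite (reindex_onto E (fun P => bt (rP P)))/=; last first.
  move=> P; rewrite inE => /andP[PP _].
  rewrite -[RHS](finset.equivalence_partition_pblock PP).
  rewrite /E /finset.equivalence_partition; apply: eq_imset => i.
  by apply/finset.setP => j; rewrite !inE tbE.
have nc b : nc_table n (tb b) -> finset.partition (E b) [set: 'I_n] /\
    forall i j : 'I_n, same_block (E b) i j = tb b i j.
  move=> /nc_tableP[e _]; split; first exact: finset.equivalence_partitionP.
  exact: same_block_partition.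
(* The condition left by the reindexing, that [E b] is noncrossing and has code b, is membership in
   L. *)
rewrite (eq_bigl (mem L)) => [|b]; last first.
  rewrite inE [in RHS]inE LE; apply/andP/idP => [[/andP[PE ncE] /eqP be]|ncb].
    have tE (i j : 'I_n) : tb b i j = same_block (E b) i j by rewrite -tbE// be.
    apply/nc_tableP; split.
      move=> i j l iT jT lT; rewrite !tE.
      exact: (same_block_equivalence PE iT jT lT).
    move=> a b0 c d ab bc cd; rewrite !tE; exact: (noncrossingP PE).
  have [PE tE] := nc _ ncb; split.
    rewrite PE/=; apply/noncrossingP => // a b0 c d ab bc cd; rewrite !tE.
    by have /nc_tableP[_] := ncb; exact.
  apply/eqP/tbK => i j; rewrite !inE => ni nj.
  by have := rPE (E b) (Ordinal ni) (Ordinal nj); rewrite tE.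
rewrite -big_uniq//=; apply: eq_big_seq => b; rewrite LE => ncb.
have [PE tE] := nc _ ncb.
rewrite prod_blocks// big_mkord; apply: eq_big => [i|i _]; last first.
  by rewrite big_mkord; congr k; apply: eq_bigr => j _; rewrite tE.
congr negb; apply/existsP/hasP => [[j /andP[ji]]|[j]].
  by rewrite tE => t; exists (val j) => //; rewrite mem_iota.
rewrite mem_iota add0n => /= ji t.
have nj : (j < n)%N by exact: ltn_trans ji (ltn_ord i).
by exists (Ordinal nj); rewrite /= ji tE.
Qed.

End sum_NC.

(** * The partition sums for n <= 4 *)

Section low_order_cumulants.

(* A partition of {0, ..., n-1} is coded by the bits b_ij, i < j, telling whether
   i and j are in the same block. *)
Definition symtab (f : nat -> nat -> bool) : rel nat :=
  fun i j => if i == j then true else f (minn i j) (maxn i j).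

Lemma symtab_eq n (f : nat -> nat -> bool) (r : rel nat) :
  {in [set: 'I_n] & &, equivalence_rel (fun i j : 'I_n => r i j)} ->
  (forall i j, (i < j < n)%N -> f i j = r i j) -> {in gtn n &, symtab f =2 r}.
Proof.
move=> er fr i j; rewrite !inE /symtab => ni nj.
have refl x (nx : (x < n)%N) : r x x.
  by have [] := er (Ordinal nx) (Ordinal nx) (Ordinal nx)
    (finset.in_setT _) (finset.in_setT _) (finset.in_setT _).
case: (ltngtP i j) => [ij|ji|<-]; last by rewrite refl.
  by rewrite fr ?ij.
rewrite fr ?ji//.
have [_ H1] := er (Ordinal ni) (Ordinal nj) (Ordinal ni)
  (finset.in_setT _) (finset.in_setT _) (finset.in_setT _).
have [_ H2] := er (Ordinal nj) (Ordinal ni) (Ordinal nj)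
  (finset.in_setT _) (finset.in_setT _) (finset.in_setT _).
move: H1 H2 => /=; rewrite !refl//.
by move=> H1 H2; apply/idP/idP => h; [rewrite -(H2 h)|rewrite -(H1 h)].
Qed.

Context {R : comNzRingType}.
Implicit Type k : nat -> R.

Lemma sum_NC1 k : \sum_(P in NC 1) \prod_(V in P) k #|V| = k 1%N.
Proof.
rewrite (@sum_NC _ 1 k unit (fun _ => symtab (fun _ _ => true)) (fun=> tt) [:: tt]) //.
- by rewrite unlock /=; ring.
- by case.
- by move=> r er /=; apply: (symtab_eq er) => i j; lia.
Qed.

Lemma sum_NC2 k : \sum_(P in NC 2) \prod_(V in P) k #|V| = k 2%N + k 1%N ^+ 2.
Proof.
rewrite (@sum_NC _ 2 k bool (fun b => symtab (fun _ _ => b)) (fun r => r 0 1)%N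
  [:: true; false]) //.
- by rewrite unlock /=; ring.
- by move=> b r /(_ 0 1 isT isT)%N <-.
- move=> r er /=; apply: (symtab_eq er) => i j ij.
  by have [-> ->] : (i = 0 /\ j = 1)%N by lia.
- by case.
Qed.

Lemma sum_NC3 k : \sum_(P in NC 3) \prod_(V in P) k #|V| =
  k 3%N + 3 * k 2%N * k 1%N + k 1%N ^+ 3.
Proof.
pose f (b : bool * bool * bool) i j :=
  let: (b01, b02, b12) := b in if i == 0%N then if j == 1%N then b01 else b02 else b12.
rewrite (@sum_NC _ 3 k _ (fun b => symtab (f b)) (fun r => (r 0 1, r 0 2, r 1 2))%N
  [:: (true, true, true); (true, false, false); (false, true, false);
      (false, false, true); (false, false, false)]) //.
- by rewrite unlock /=; ring.
- move=> [[b01 b02] b12] r e.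
  by rewrite -!e.
- move=> r er /=; apply: (symtab_eq er) => i j ij.
  have : [|| (i == 0) && (j == 1), (i == 0) && (j == 2) | (i == 1) && (j == 2)]%N by lia.
  by case/or3P => /andP[/eqP-> /eqP->].
- by case=> [[[] []] []].
Qed.

(** Of the fifteen partitions of {0, 1, 2, 3} only {0, 2}, {1, 3} crosses. It is absent from the
    list, whence the coefficient 2, and not 3, of the square of [k 2]. *)
Lemma sum_NC4 k : \sum_(P in NC 4) \prod_(V in P) k #|V| =
  k 4%N + 4 * k 3%N * k 1%N + 2 * k 2%N ^+ 2 + 6 * k 2%N * k 1%N ^+ 2 + k 1%N ^+ 4.
Proof.
pose f (b : bool * bool * bool * bool * bool * bool) i j :=
  let: (b01, b02, b03, b12, b13, b23) := b in
  if i == 0%N then if j == 1%N then b01 else if j == 2%N then b02 else b03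
  else if i == 1%N then if j == 2%N then b12 else b13 else b23.
pose T := true; pose F := false.
rewrite (@sum_NC _ 4 k _ (fun b => symtab (f b))
  (fun r => (r 0 1, r 0 2, r 0 3, r 1 2, r 1 3, r 2 3))%N
  [:: (T, T, T, T, T, T); (T, T, F, T, F, F); (T, F, T, F, T, F);
      (F, T, T, F, F, T); (F, F, F, T, T, T); (T, F, F, F, F, T); (F, F, T, T, F, F);
      (T, F, F, F, F, F); (F, T, F, F, F, F); (F, F, T, F, F, F);
      (F, F, F, T, F, F); (F, F, F, F, T, F); (F, F, F, F, F, T);
      (F, F, F, F, F, F)]) //.
- by rewrite unlock /=; ring.
- move=> [[[[[b01 b02] b03] b12] b13] b23] r e.
  by rewrite -!e.
- move=> r er /=; apply: (symtab_eq er) => i j ij.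
  have : [|| (i == 0) && (j == 1), (i == 0) && (j == 2), (i == 0) && (j == 3),
    (i == 1) && (j == 2), (i == 1) && (j == 3) | (i == 2) && (j == 3)]%N by lia.
  by case/or4P => [|||/or3P[]] => /andP[/eqP-> /eqP->].
(* All 64 bit vectors are checked: membership in the list against [nc_table]. *)
- by case=> [[[[[[] []] []] []] []] []].
Qed.

End low_order_cumulants.

Section D1_moments.
Context {R : realType}.

(** The moments are substituted by their expressions in the cumulants, so each identity is
    polynomial in the values of [k] and no system has to be solved. *)
Lemma free_cumulantsE (mu : probability (measurableTypeR R) R) :
  let m := moment mu in let k := free_cumulant mu in
  [/\ k 2%N = m 2%N - m 1%N ^+ 2,
      k 3%N = m 3%N - 3 * m 1%N * m 2%N + 2 * m 1%N ^+ 3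
    & k 4%N = m 4%N - 4 * m 1%N * m 3%N - 2 * m 2%N ^+ 2
               + 10 * m 1%N ^+ 2 * m 2%N - 5 * m 1%N ^+ 4].
Proof.
move=> m k; have mk := free_cumulantP mu.
have := mk 1%N isT; have := mk 2%N isT; have := mk 3%N isT; have := mk 4%N isT.
rewrite sum_NC1 sum_NC2 sum_NC3 sum_NC4 -/m -/k => -> -> -> ->.
by split; ring.
Qed.

End D1_moments.

(** * Moments of the beta distribution *)

Section beta_moments.
Context {R : realType}.
Local Open Scope classical_set_scope.
Local Notation leb := (@lebesgue_measure R).
Implicit Types p q a b r x : R.

Lemma is_derive1_powR (r x : R) : 0 < x ->
  is_derive x 1 (fun y : R => y `^ r) (r * x `^ (r - 1)).
Proof.
move=> x0; have xI : x \in `]0, +oo[%R by rewrite in_itv/= x0.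
by apply: DeriveDef; [exact: derivable_powR|rewrite -derive1E powR_derive1].
Qed.

Lemma beta_kernelSl p q x : 0 < p -> 0 <= x -> beta_kernel (p + 1) q x = x * beta_kernel p q x.
Proof.
by move=> p0 x0; rewrite /beta_kernel addrK -(mulr_powRB1 x0 p0) mulrA.
Qed.

(** The primitive vanishes at 0 and 1, so the right-hand side integrates to zero over (0, 1); this
    is the recurrence [euler_betaSl]. *)
Lemma is_derive_beta_primitive p q x : 0 < p -> 0 < q -> 0 < x < 1 ->
  is_derive x 1 (fun y : R => y `^ p * (1 - y) `^ q)
    (p * beta_kernel p q x - (p + q) * beta_kernel (p + 1) q x).
Proof.
move=> p0 q0 /andP[x0 x1].
have x1' : 0 < 1 - x by rewrite subr_gt0.
have D1 := is_derive1_powR p x0.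
have D2 := is_derive1_powR q x1'.
have D3 : is_derive x 1 (fun y : R => 1 - y) (- 1).
  have -> : (fun y : R => 1 - y) = cst 1 - id by [].
  by apply: is_derive_eq; rewrite sub0r.
have D4 := @is_derive1_comp R (fun y : R => y `^ q) (fun y => 1 - y) x _ _ D2 D3.
apply: (is_derive_eq (is_deriveM D1 D4)).
rewrite beta_kernelSl ?ltW// /beta_kernel /GRing.scale/=.
rewrite -(mulr_powRB1 (ltW x0) p0) -(mulr_powRB1 (ltW x1') q0).
ring.
Qed.

Lemma measurable_beta_kernel p q : measurable_fun [set: R] (beta_kernel p q).
Proof.
apply: measurable_funM; first exact: measurable_powR.
apply: (measurableT_comp (measurable_powR (q - 1))).
exact: measurable_funB.
Qed.

Lemma beta_kernel_ge0 p q x : 0 <= beta_kernel p q x.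
Proof. by rewrite mulr_ge0// powR_ge0. Qed.

Lemma integrable_beta_kernel p q : 0 < p -> 0 < q ->
  leb.-integrable `]0%R, 1%R[ (EFin \o beta_kernel p q).
Proof.
move=> p0 q0; apply/integrableP; split.
  by apply/measurable_EFinP/measurable_funTS; exact: measurable_beta_kernel.
under eq_integral do rewrite /= ger0_norm ?beta_kernel_ge0//.
by rewrite EFin_euler_beta// ltry.
Qed.

Lemma continuous_beta_kernel p q x : 0 < x < 1 -> {for x, continuous (beta_kernel p q)}.
Proof.
move=> /andP[x0 x1].
have c (r y : R) : 0 < y -> {for y, continuous (fun z : R => z `^ r)}.
  move=> y0; apply: differentiable_continuous; apply/derivable1_diffP.
  by apply: derivable_powR; rewrite in_itv/= y0.
apply: cvgM; first exact: c.
have C1 : 1 - y @[y --> x] --> 1 - x by apply: cvgB; [exact: cvg_cst|exact: cvg_id].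
have x1' : 0 < 1 - x by rewrite subr_gt0.
exact: (cvg_comp _ _ C1 (@c (q - 1) (1 - x) x1')).
Qed.

(** The kernel is unbounded at 0 when p < 1 and at 1 when q < 1. On a compact subinterval it is
    continuous and the fundamental theorem of calculus applies. *)
Lemma integral_beta_derivative p q a b : 0 < p -> 0 < q -> 0 < a -> a < b -> b < 1 ->
  p * (\int[leb]_(x in `[a, b]) beta_kernel p q x)
    - (p + q) * (\int[leb]_(x in `[a, b]) beta_kernel (p + 1) q x) =
  b `^ p * (1 - b) `^ q - a `^ p * (1 - a) `^ q.
Proof.
move=> p0 q0 a0 ab b1.
have in01 x : a <= x <= b -> 0 < x < 1.
  by move=> /andP[ax xb]; rewrite (lt_le_trans a0 ax) (le_lt_trans xb b1).
have cF x : a <= x <= b -> {for x, continuous (fun y : R => y `^ p * (1 - y) `^ q)}.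
  move=> /in01 x01; apply: differentiable_continuous; apply/derivable1_diffP.
  have D := is_derive_beta_primitive p0 q0 x01; exact: ex_derive.
have sub : `[a, b] `<=` `]0%R, 1%R[ by move=> x; rewrite /= !in_itv/=; exact: in01.
have p1 : 0 < p + 1 by rewrite addr_gt0.
have i r : 0 < r -> leb.-integrable `[a, b] (EFin \o beta_kernel r q).
  by move=> r0; have := integrable_beta_kernel r0 q0; apply: integrableS.
have ic c r : 0 < r -> leb.-integrable `[a, b] (EFin \o (fun x => c * beta_kernel r q x)).
  by move=> r0; exact: (@integrableZl _ _ _ leb _ (measurable_itv _) c _ (i r r0)).
rewrite -RintegralZl ?i// -RintegralZl ?i// -RintegralB ?ic//.
have c x : a <= x <= b -> {for x, continuous
    (fun x => p * beta_kernel p q x - (p + q) * beta_kernel (p + 1) q x)}.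
  move=> /in01 x01; apply: cvgB; apply: cvgM;
    by [exact: cvg_cst|exact: continuous_beta_kernel].
rewrite /Rintegral.
rewrite (@continuous_FTC2 _ _ (fun y : R => y `^ p * (1 - y) `^ q))//=.
- apply/continuous_in_subspaceT => x; rewrite inE/= in_itv/=; exact: c.
- split.
  + move=> x; rewrite in_itv/= => /andP[ax xb].
    have x01 : 0 < x < 1 by apply: in01; rewrite !ltW.
    have D := is_derive_beta_primitive p0 q0 x01; exact: ex_derive.
  + by apply: cvg_at_right_filter; apply: cF; rewrite lexx ltW.
  + by apply: cvg_at_left_filter; apply: cF; rewrite lexx ltW.
- move=> x; rewrite in_itv/= => /andP[ax xb].
  have x01 : 0 < x < 1 by apply: in01; rewrite !ltW.
  have D := is_derive_beta_primitive p0 q0 x01.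
  by rewrite derive1E; exact: derive_val.
Qed.

(** [integral_beta_derivative] on intervals exhausting (0, 1): the integrals pass to the limit by
    monotone convergence, and the boundary terms tend to 0 because p and q are positive. *)
Lemma euler_betaSl p q : 0 < p -> 0 < q ->
  (p + q) * euler_beta (p + 1) q = p * euler_beta p q.
Proof.
move=> p0 q0; have p1 : 0 < p + 1 by rewrite addr_gt0.
(* Starting at 1/3 keeps e n < 1 - e n, so that no interval is degenerate. *)
pose e n : R := n.+3%:R^-1.
have e0 n : 0 < e n by rewrite invr_gt0.
have e3 n : e n <= 3^-1 by rewrite lef_pV2 ?posrE// ler_nat.
pose F n : set R := `[e n, 1 - e n].
have FE : \bigcup_n F n = `]0%R, 1%R[.
  apply/seteqP; split => x.
    move=> [n _]; rewrite /F /= !in_itv/= => /andP[A B].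
    by apply/andP; split; [exact: lt_le_trans A|apply: le_lt_trans B _; rewrite gtrBl].
  rewrite /= in_itv/= => /andP[x0 x1].
  have m0 : 0 < Num.min x (1 - x) by rewrite lt_min x0 subr_gt0.
  have [n /ltW] : exists n, n.+1%:R^-1 < Num.min x (1 - x).
    have [n _ H] := near_infty_natSinv_lt (PosNum m0).
    by exists n; exact: (H n (leqnn n)).
  rewrite le_min => /andP[A B].
  exists n => //; rewrite /F /= in_itv/=.
  have : e n <= n.+1%:R^-1 :> R by rewrite lef_pV2 ?posrE ?ltr0n ?ler_nat//; lia.
  move: (e n) (n.+1%:R^-1) A B => a b A B ab.
  by apply/andP; split; lra.
have cvgF r : 0 < r ->
    \int[leb]_(x in F n) beta_kernel r q x @[n --> \oo] --> euler_beta r q.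
  move=> r0; apply: fine_cvg; rewrite -EFin_euler_beta// -FE.
  apply: ge0_nondecreasing_set_cvg_integral => //.
  - move=> m n mn; apply/subsetPset => x; rewrite /F /= !in_itv/=.
    have : e n <= e m by rewrite lef_pV2 ?posrE// ler_nat !ltnS.
    move: (e n) (e m) => a b ab /andP[A B].
    by apply/andP; split; lra.
  - by move=> n; exact: measurable_itv.
  - by move=> n; apply/measurable_EFinP/measurable_funTS; exact: measurable_beta_kernel.
  - by move=> n x _; rewrite lee_fin beta_kernel_ge0.
have ecvg : e n @[n --> \oo] --> (0 : R).
  have := @cvg_harmonic R; rewrite -(cvg_shiftn 2); apply: cvg_trans.
  by apply: near_eq_cvg; apply: nearW => n; rewrite /harmonic /= addn2.
have powe r : 0 < r -> e n `^ r @[n --> \oo] --> (0 : R).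
  by move=> r0; have /cvg_at_rightP := powR_cvg0 r0; apply; split.
pose X n := (1 - e n) `^ p * (e n) `^ q - e n `^ p * (1 - e n) `^ q.
have X0 : X n @[n --> \oo] --> (0 : R).
  have le1 r n : 0 < r -> 0 <= (1 - e n) `^ r <= 1.
    move=> r0; rewrite powR_ge0/=; apply: (@le_trans _ _ (1 `^ r)); last by rewrite powR1.
    have := e0 n; have := e3 n => ? ?.
    apply: ge0_ler_powR; rewrite ?nnegrE ?(ltW r0)//; lra.
  rewrite -[0](subr0 0); apply: cvgB.
    apply: (@squeeze_cvgr _ _ _ _ (cst 0) (fun n => e n `^ q)).
    - apply: nearW => n /=; have /andP[? ?] := le1 p n p0.
      by rewrite mulr_ge0 ?powR_ge0//= ler_piMl ?powR_ge0.
    - exact: cvg_cst.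
    - exact: powe.
  apply: (@squeeze_cvgr _ _ _ _ (cst 0) (fun n => e n `^ p)).
  - apply: nearW => n /=; have /andP[? ?] := le1 q n q0.
    by rewrite mulr_ge0 ?powR_ge0//= ler_piMr ?powR_ge0.
  - exact: cvg_cst.
  - exact: powe.
have X1 : X n @[n --> \oo] --> p * euler_beta p q - (p + q) * euler_beta (p + 1) q.
  have -> : X = fun n => p * (\int[leb]_(x in F n) beta_kernel p q x)
      - (p + q) * (\int[leb]_(x in F n) beta_kernel (p + 1) q x).
    apply/funext => n; have := e0 n; have := e3 n => e3n e0n.
    rewrite /F integral_beta_derivative//; last 2 first.
    - by lra.
    - by lra.
    by rewrite subKr.
  by apply: cvgB; apply: cvgM => //; [exact: cvg_cst|exact: cvgF|exact: cvg_cst|exact: cvgF].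
apply/eqP; rewrite eq_sym -subr_eq0; apply/eqP.
by rewrite -(cvg_lim (@Rhausdorff R) X1) (cvg_lim (@Rhausdorff R) X0).
Qed.

End beta_moments.

(** * Integration against the beta law *)

Section beta_law_integral.
Context {R : realType} (p q : R) (hp : 0 < p) (hq : 0 < q).
Local Open Scope classical_set_scope.
Local Notation leb := (@lebesgue_measure R).
Local Notation beta := (beta_law hp hq).

Lemma beta_law_dominated : beta `<< leb.
Proof.
apply/null_content_dominatesP => A mA A0.
apply: null_set_integral => //.
by apply/measurable_EFinP/measurable_funTS; exact: measurable_beta_density.
Qed.

(** The abstract Radon-Nikodym derivative agrees almost everywhere with [beta_density], since both
    have the same integral over every measurable set. *)
Lemma integral_beta_law (f : R -> \bar R) :
  (forall x, 0 <= f x)%E -> measurable_fun [set: R] f ->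
  (\int[beta]_x f x = \int[leb]_x (f x * (beta_density p q x)%:E))%E.
Proof.
move=> f0 mf.
rewrite -(Radon_Nikodym_SigmaFinite.change_of_variables beta_law_dominated)//.
have iRN := Radon_Nikodym_SigmaFinite.f_integrable beta_law_dominated.
have mRN := measurable_int _ iRN.
have md : measurable_fun [set: R] (EFin \o beta_density p q).
  by apply/measurable_EFinP; exact: measurable_beta_density.
apply: ae_eq_integral => //; [exact: emeasurable_funM..|].
apply: ae_eqe_mul2l; apply: integral_ae_eq => // E _ mE.
by rewrite -Radon_Nikodym_SigmaFinite.f_integral//; exact: beta_law_dominated.
Qed.

Lemma beta_law_itvC : beta (~` `]0%R, 1%R[) = 0%E.
Proof.
rewrite /beta_law integral0_eq// => x; rewrite /= in_itv/= /beta_density.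
by move=> /negP/negbTE ->.
Qed.

Lemma moment_beta_law n : moment beta n = euler_beta (p + n%:R) q / euler_beta p q.
Proof.
rewrite /moment /Rintegral.
(* [integral_beta_law] asks for a nonnegative integrand; the absolute value changes nothing on (0,
   1), which carries the whole mass. *)
transitivity (fine (\int[beta]_x (`|x| ^+ n)%:E)%E).
  congr fine; apply: ae_eq_integral => //.
  - by apply/measurable_EFinP; exact: measurable_funX.
  - by apply/measurable_EFinP; apply: measurable_funX; exact: normr_measurable.
  exists (~` `]0%R, 1%R[); split.
  - by apply: measurableC; exact: measurable_itv.
  - exact: beta_law_itvC.
  move=> x /= H; rewrite in_itv/= => /andP[x0 _]; apply: H => _.
  by rewrite gtr0_norm.
rewrite integral_beta_law; last 2 first.
- by move=> x; rewrite lee_fin exprn_ge0.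
- by apply/measurable_EFinP; apply: measurable_funX; exact: normr_measurable.
transitivity (fine (\int[leb]_(x in `]0%R, 1%R[)
    ((beta_kernel (p + n%:R) q x)%:E * ((euler_beta p q)^-1)%:E))%E).
  rewrite [in RHS]integral_mkcond/=; congr fine; apply: eq_integral => x _.
  rewrite patchE /beta_density mem_setE in_itv/=.
  case: ifPn => [/andP[x0 x1]|]; last by rewrite mule0.
  rewrite -!EFinM mulrA (gtr0_norm x0); congr (_ * _)%:E.
  rewrite /beta_kernel mulrA; congr (_ * _).
  rewrite -powR_mulrn ?ltW// -powRD; last by rewrite (gt_eqF x0) implybT.
  by rewrite addrA [n%:R + p]addrC.
have pn0 : 0 < p + n%:R by rewrite ltr_wpDr.
rewrite ge0_integralZr//=.
- by rewrite EFin_euler_beta.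
- by apply/measurable_EFinP/measurable_funTS; exact: measurable_beta_kernel.
- by move=> x _; rewrite lee_fin beta_kernel_ge0.
- by rewrite lee_fin invr_ge0 ltW// euler_beta_gt0.
Qed.

Lemma moment_beta_lawS n :
  moment beta n.+1 = (p + n%:R) / (p + q + n%:R) * moment beta n.
Proof.
have pn0 : 0 < p + n%:R by rewrite ltr_wpDr.
have := euler_betaSl pn0 hq; rewrite !moment_beta_law -[n.+1]addn1 natrD addrA.
have := euler_beta_gt0 hp hq => /lt0r_neq0 B0.
have s0 : p + q + n%:R != 0 by rewrite gt_eqF// ltr_wpDr// addr_gt0.
move=> e; have -> : euler_beta (p + n%:R + 1) q =
    (p + n%:R) * euler_beta (p + n%:R) q / (p + q + n%:R).
  by rewrite -e; field.
by field; rewrite B0 s0.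
Qed.

Lemma moment_beta_law0 : moment beta 0 = 1.
Proof. by rewrite moment_beta_law addr0 divff// gt_eqF// euler_beta_gt0. Qed.

End beta_law_integral.

(** * Complex-valued integrals and resolvents *)

Section complex_integral.
Context {R : realType}.
Local Open Scope classical_set_scope.
Local Open Scope complex_scope.
Local Notation C := R[i].
Local Notation Re := complex.Re.
Local Notation Im := complex.Im.
Local Notation law := (probability (measurableTypeR R) R).
Implicit Types (mu : law) (f g : R -> C) (z w c : C) (t : R).

Definition cintegrable mu f :=
  mu.-integrable setT (EFin \o (fun t => Re (f t))) /\
  mu.-integrable setT (EFin \o (fun t => Im (f t))).

Definition cint mu f : C := (\int[mu]_t Re (f t)) +i* (\int[mu]_t Im (f t)).

Lemma cReD z w : Re (z + w) = Re z + Re w. Proof. by case: z; case: w. Qed.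
Lemma cImD z w : Im (z + w) = Im z + Im w. Proof. by case: z; case: w. Qed.
Lemma cImN z : Im (- z) = - Im z. Proof. by case: z. Qed.
Lemma cReM z w : Re (z * w) = Re z * Re w - Im z * Im w. Proof. by case: z; case: w. Qed.
Lemma cImM z w : Im (z * w) = Re z * Im w + Im z * Re w.
Proof. by case: z => a b; case: w => a' b'; rewrite /= addrC. Qed.
Lemma cReV z : Re z^-1 = Re z / (Re z ^+ 2 + Im z ^+ 2). Proof. by case: z. Qed.
Lemma cImV z : Im z^-1 = - (Im z / (Re z ^+ 2 + Im z ^+ 2)). Proof. by case: z. Qed.

Lemma complex_ext z w : Re z = Re w -> Im z = Im w -> z = w.
Proof. by case: z; case: w => /= ? ? ? ? -> ->. Qed.

Lemma integrable_lin mu (a b : R) (f g : R -> R) :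
  mu.-integrable setT (EFin \o f) -> mu.-integrable setT (EFin \o g) ->
  mu.-integrable setT (EFin \o (fun t => a * f t + b * g t)) /\
  \int[mu]_t (a * f t + b * g t) = a * \int[mu]_t f t + b * \int[mu]_t g t.
Proof.
move=> If Ig.
have Iaf := @integrableZl _ _ _ mu _ measurableT a _ If.
have Ibg := @integrableZl _ _ _ mu _ measurableT b _ Ig.
split; first by have := integrableD measurableT Iaf Ibg; apply.
by rewrite RintegralD// RintegralZl// RintegralZl.
Qed.

(** One link of a chain: the linear combinations below are built from a constant by repeating this
    form, and the integrability half feeds the next link. *)
Lemma cint_lin mu c f g : cintegrable mu f -> cintegrable mu g ->
  cintegrable mu (fun t => c * f t + g t) /\
  cint mu (fun t => c * f t + g t) = c * cint mu f + cint mu g.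
Proof.
move=> [If1 If2] [Ig1 Ig2].
have [J1 E1] := integrable_lin (Re c) (- Im c) If1 If2.
have [J2 E2] := integrable_lin (Re c) (Im c) If2 If1.
have [K1 F1] := integrable_lin 1 1 J1 Ig1.
have [K2 F2] := integrable_lin 1 1 J2 Ig2.
have e1 t : Re (c * f t + g t) =
    1 * (Re c * Re (f t) + - Im c * Im (f t)) + 1 * Re (g t).
  by rewrite cReD cReM; ring.
have e2 t : Im (c * f t + g t) =
    1 * (Re c * Im (f t) + Im c * Re (f t)) + 1 * Im (g t).
  by rewrite cImD cImM; ring.
split.
  by split; [under eq_fun do rewrite /= e1|under eq_fun do rewrite /= e2].
apply: complex_ext; rewrite /cint /=.
  under eq_Rintegral do rewrite e1.
  by rewrite F1 E1 cReD cReM/=; ring.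
under eq_Rintegral do rewrite e2.
by rewrite F2 E2 cImD cImM/=; ring.
Qed.

Lemma cint_cst mu c : cintegrable mu (fun=> c) /\ cint mu (fun=> c) = c.
Proof.
split; first by split; exact: finite_measure_integrable_cst.
by apply: complex_ext; rewrite /cint/= Rintegral_cst// [X in fine X]probability_setT mulr1.
Qed.

Definition resolvent w t : C := (w - t%:C)^-1.

Lemma sub_real_neq0 w t : 0 < Im w -> w - t%:C != 0.
Proof.
move=> w0; apply/negP => /eqP e.
by have := congr1 (@complex.Im R) e; rewrite cImD cImN/= subr0 => w00; rewrite w00 ltxx in w0.
Qed.

Let den w t : R := (Re w - t) ^+ 2 + Im w ^+ 2.

Let den_gt0 w t : 0 < Im w -> 0 < den w t.
Proof. by move=> w0; rewrite ltr_wpDl ?sqr_ge0// exprn_gt0. Qed.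

Lemma Re_resolvent w t : Re (resolvent w t) = (Re w - t) / ((Re w - t) ^+ 2 + Im w ^+ 2).
Proof. by case: w => u v; rewrite /resolvent cReV /= subr0. Qed.

Lemma Im_resolvent w t : Im (resolvent w t) = - (Im w / ((Re w - t) ^+ 2 + Im w ^+ 2)).
Proof. by case: w => u v; rewrite /resolvent cImV /= subr0. Qed.

Lemma cauchy_transformE mu w : cauchy_transform mu w = cint mu (resolvent w).
Proof. by []. Qed.

Lemma integrable_bounded mu (f : R -> R) (M : R) :
  measurable_fun setT f -> {ae mu, forall t, `|f t| <= M} ->
  mu.-integrable setT (EFin \o f).
Proof.
move=> mf fM; apply/integrableP; split; first exact/measurable_EFinP.
apply: (@le_lt_trans _ _ (`|M|%:E * mu setT)%E); last first.
  by rewrite [X in (_ * X)%E]probability_setT mule1 ltry.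
apply: integral_le_bound => //; first exact/measurable_EFinP.
apply: (@filterS _ _ (ae_filter_ringOfSetsType mu) _ _ _ fM) => t H _.
by rewrite lee_fin (le_trans H)// ler_norm.
Qed.

Lemma cintegrable_resolvent mu w : 0 < Im w -> cintegrable mu (resolvent w).
Proof.
move=> w0.
have cden t : {for t, continuous (fun t => (den w t)^-1)}.
  apply: cvgV; first by rewrite gt_eqF// den_gt0.
  apply: cvgD; last exact: cvg_cst.
  by apply: cvgM; apply: cvgB; [exact: cvg_cst|exact: cvg_id|exact: cvg_cst|exact: cvg_id].
split; apply: (@integrable_bounded _ _ (Im w)^-1).
- rewrite (_ : (fun t => _) = (fun t => (Re w - t) * (den w t)^-1)).
    apply: continuous_measurable_fun => t; apply: cvgM; last exact: cden.
    by apply: cvgB; [exact: cvg_cst|exact: cvg_id].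
  by apply/funext => t; rewrite Re_resolvent.
- apply: aeW => t; rewrite Re_resolvent normrM normfV (gtr0_norm (den_gt0 _ w0)).
  rewrite ler_pdivrMr ?den_gt0// mulrC ler_pdivlMr//.
  rewrite /den -(real_normK (num_real (Re w - t))).
  have := sqr_ge0 (`|Re w - t| - Im w); have := normr_ge0 (Re w - t); nra.
- rewrite (_ : (fun t => _) = (fun t => - (Im w * (den w t)^-1))).
    apply: continuous_measurable_fun => t; apply: cvgN; apply: cvgM; last exact: cden.
    exact: cvg_cst.
  by apply/funext => t; rewrite Im_resolvent.
- apply: aeW => t; rewrite Im_resolvent normrN normrM normfV (gtr0_norm (den_gt0 _ w0)).
  rewrite (gtr0_norm w0).
  rewrite ler_pdivrMr ?den_gt0// mulrC ler_pdivlMr//.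
  by rewrite /den -expr2 lerDr sqr_ge0.
Qed.

(** The resolvent identity: it integrates a product of two resolvents through a difference of Cauchy
    transforms. *)
Lemma resolventB w1 w2 t : 0 < Im w1 -> 0 < Im w2 ->
  resolvent w1 t - resolvent w2 t = (w2 - w1) * (resolvent w1 t * resolvent w2 t).
Proof.
move=> h1 h2; rewrite /resolvent.
by field; rewrite !sub_real_neq0.
Qed.

End complex_integral.

(** * The Voiculescu transform on the imaginary axis *)
Section ray.
Context {R : realType}.
Local Open Scope classical_set_scope.
Local Open Scope complex_scope.
Local Notation C := R[i].
Local Notation Re := complex.Re.
Local Notation Im := complex.Im.
Local Notation law := (probability (measurableTypeR R) R).
Implicit Types (mu : law) (phi psi : R -> C).

(* Only the imaginary axis matters; phi y stands for the value at iy. *)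
Definition ray_transform mu phi : Prop :=
  (\forall y \near +oo, 0 < Im (0 +i* y + phi y) /\
     cauchy_transform mu (0 +i* y + phi y) = (0 +i* y)^-1) /\
  (forall e : R, 0 < e -> \forall y \near +oo,
     `|Re (phi y)| <= e * y /\ `|Im (phi y)| <= e * y).

Lemma normc_ge_ReIm (z : C) (r : R) : `|z| <= r%:C -> `|Re z| <= r /\ `|Im z| <= r.
Proof.
rewrite normc_def lecR; case: z => a b /= h; split; apply: le_trans h.
  by rewrite -sqrtr_sqr ler_wsqrtr// lerDl sqr_ge0.
by rewrite -sqrtr_sqr ler_wsqrtr// lerDr sqr_ge0.
Qed.

Lemma near_pinfty_gt (c : R) : \forall y \near +oo, c < y.
Proof. by apply: nbhs_pinfty_gt; exact: num_real. Qed.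

Lemma near_pinfty_ge (c : R) : \forall y \near +oo, c <= y.
Proof. by apply: nbhs_pinfty_ge; exact: num_real. Qed.

Lemma le_Im_normc (z : C) : `|Im z|%:C <= `|z|.
Proof.
by rewrite normc_def lecR -sqrtr_sqr ler_wsqrtr// lerDr sqr_ge0.
Qed.

Lemma near_pinfty_double (P : R -> Prop) :
  (\forall y \near +oo, P y) -> \forall y \near +oo, P (2 * y).
Proof.
move=> [N [_ NP]]; near=> y; apply: NP.
suff : Num.max 0 N < y by rewrite gt_max => /andP[? ?]; lra.
by near: y; exact: near_pinfty_gt.
Unshelve. all: by end_near. Qed.

Lemma cvg_dist_pinfty (f : R -> R) (l M : R) :
  (\forall y \near +oo, `|f y - l| <= M / y) -> f y @[y --> +oo] --> l.
Proof.
move=> fM; apply/cvgrPdist_le => e e0; near=> y.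
have y0 : 0 < y by near: y; exact: near_pinfty_gt.
have h : `|f y - l| <= M / y by near: y.
have yM : e^-1 * M <= y by near: y; exact: near_pinfty_ge.
by rewrite distrC; apply: (le_trans h); rewrite ler_pdivrMr// -ler_pdivrMl.
Unshelve. all: by end_near. Qed.

(** Every truncated cone contains iy for all large y, whatever its aperture, so transforms given on
    different cones become comparable on the axis. *)
Lemma is_voiculescu_transform_ray a b mu (phi : C -> C) : 0 < a ->
  is_voiculescu_transform a b mu phi -> ray_transform mu (fun y => phi (0 +i* y)).
Proof.
move=> a0 [inv small].
have cone y : Num.max 0 b < y -> truncated_cone a b (0 +i* y).
  rewrite gt_max => /andP[y0 yb]; split => //=.
  by rewrite normr0 mulr_gt0.
have normy y : 0 < y -> `|0 +i* y| = y%:C :> C.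
  by move=> y0; rewrite normc_def /= expr0n add0r sqrtr_sqr gtr0_norm.
split.
  near=> y; have [|_ im inve] := inv (0 +i* y);
    first by apply: cone; near: y; exact: near_pinfty_gt.
  by split => //; rewrite -[RHS](congr1 GRing.inv inve) /reciprocal_cauchy_transform invrK.
move=> e e0; have [M HM] := small e e0.
near=> y.
have y0 : 0 < y by near: y; exact: near_pinfty_gt.
apply: normc_ge_ReIm; rewrite rmorphM/= -(normy y)//; apply: HM.
  by apply: cone; near: y; exact: near_pinfty_gt.
by rewrite normy// ltcR; near: y; exact: near_pinfty_gt.
Unshelve. all: by end_near. Qed.

Lemma law_tight mu (r : R) : r < 1 -> exists2 T : R, 0 < T & (r%:E <= mu `[(- T)%R, T%R])%E.
Proof.
move=> r1; pose F (n : nat) : set (measurableTypeR R) := `[- n.+1%:R, n.+1%:R].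
have FT : \bigcup_n F n = setT.
  apply/seteqP; split => // t _; exists (Num.truncn `|t|) => //.
  rewrite /F /= in_itv/= -ler_norml ltW//.
  by have /andP[] := truncn_itv (normr_ge0 t).
have : mu (F n) @[n --> \oo] --> mu (\bigcup_n F n).
  apply: nondecreasing_cvg_mu => //.
  - by move=> n; exact: measurable_itv.
  - by apply: bigcup_measurable => n _; exact: measurable_itv.
  - move=> m n mn; apply/subsetPset => t; rewrite /F /= !in_itv/= -!ler_norml.
    by move=> /le_trans; apply; rewrite ler_nat.
rewrite FT probability_setT => cF.
have [[n h]|H] := pselect (exists n, (r%:E <= mu (F n))%E); first by exists n.+1%:R.
have : (1%:E <= r%:E :> \bar R)%E.
  rewrite -(cvg_lim (@ereal_hausdorff R) cF); apply: lime_le.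
    by apply/cvg_ex; eexists; exact: cF.
  by apply: nearW => n; rewrite ltW// ltNge; apply/negP => h; apply: H; exists n.
by rewrite lee_fin leNgt r1.
Qed.

(* The quotient is - y^2 Re (1 / ((w1 - t) (w2 - t))) for w_k = u_k + i v_k. *)
Lemma resolvent_prod_bounds (y u1 u2 v1 v2 t : R) : 0 < y ->
  `|u1| <= 10^-1 * y -> `|u2| <= 10^-1 * y ->
  `|v1 - y| <= 10^-1 * y -> `|v2 - y| <= 10^-1 * y ->
  let D := ((u1 - t) ^+ 2 + v1 ^+ 2) * ((u2 - t) ^+ 2 + v2 ^+ 2) in
  0 < D /\ - (5 / 4) <= y ^+ 2 * (v1 * v2 - (u1 - t) * (u2 - t)) / D /\
  (`|t| <= 10^-1 * y -> 9 / 20 <= y ^+ 2 * (v1 * v2 - (u1 - t) * (u2 - t)) / D).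
Proof.
move=> y0; rewrite !ler_norml => /andP[a1 a2] /andP[b1 b2] /andP[c1 c2] /andP[d1 d2].
move=> D.
have v1y : 9 / 10 * y <= v1 by lra.
have v2y : 9 / 10 * y <= v2 by lra.
have v1y' : v1 <= 11 / 10 * y by lra.
have v2y' : v2 <= 11 / 10 * y by lra.
have y20 : 0 < y ^+ 2 by rewrite exprn_gt0.
have vv : 81 / 100 * y ^+ 2 <= v1 * v2.
  have : (9 / 10 * y) * (9 / 10 * y) <= v1 * v2 by apply: ler_pM => //; lra.
  by rewrite expr2; lra.
have DX : D = ((u1 - t) * (u2 - t) - v1 * v2) ^+ 2 + ((u1 - t) * v2 + (u2 - t) * v1) ^+ 2.
  by rewrite /D; ring.
have DY : D = ((u1 - t) * (u2 - t) + v1 * v2) ^+ 2 + ((u1 - t) * v2 - (u2 - t) * v1) ^+ 2.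
  by rewrite /D; ring.
have DV : (v1 * v2) ^+ 2 <= D.
  have -> : D = (v1 * v2) ^+ 2 + ((u1 - t) ^+ 2 * (u2 - t) ^+ 2 +
     (u1 - t) ^+ 2 * v2 ^+ 2 + (u2 - t) ^+ 2 * v1 ^+ 2) by rewrite /D; ring.
  by rewrite lerDl !addr_ge0// mulr_ge0 ?sqr_ge0.
have vv0 : 0 < v1 * v2 by apply: lt_le_trans vv; rewrite mulr_gt0.
have D0 : 0 < D by apply: lt_le_trans DV; rewrite exprn_gt0.
split=> //; split.
  rewrite ler_pdivlMr//.
  set X := (u1 - t) * (u2 - t) in DX *.
  have XD : (X - v1 * v2) ^+ 2 <= D by rewrite DX lerDl sqr_ge0.
  have YD : (81 / 100 * y ^+ 2) ^+ 2 <= D.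
    by apply: le_trans DV; rewrite lerXn2r ?nnegrE ?(ltW vv0)// mulr_ge0// ltW.
  move: (X - v1 * v2) (y ^+ 2) XD YD (opprB X (v1 * v2)) => x s XD YD <-.
  (* With s = y^2, both x^2 and (81/100 s)^2 are at most D, hence s x <= 100/81 D <= 5/4 D. *)
  by have := sqr_ge0 (x - 81 / 100 * s); rewrite sqrrB; lra.
move=> /andP[t1 t2]; rewrite ler_pdivlMr//.
have sq (u : R) : - (10^-1 * y) <= u -> u <= 10^-1 * y -> (u - t) ^+ 2 <= 4 / 100 * y ^+ 2.
  move=> h1 h2; have : `|u - t| <= 2 / 10 * y by rewrite ler_norml; apply/andP; split; lra.
  move=> h; rewrite -real_normK ?num_real//.
  have : `|u - t| ^+ 2 <= (2 / 10 * y) ^+ 2 by rewrite lerXn2r ?nnegrE// mulr_ge0 ?ltW.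
  by rewrite exprMn; lra.
have s1 := sq _ a1 a2; have s2 := sq _ b1 b2.
have vs (v : R) : 9 / 10 * y <= v -> v <= 11 / 10 * y -> v ^+ 2 <= 121 / 100 * y ^+ 2.
  move=> h1 h2.
  have : v ^+ 2 <= (11 / 10 * y) ^+ 2 by rewrite lerXn2r ?nnegrE//; lra.
  by rewrite exprMn; lra.
have w1 := vs _ v1y v1y'; have w2 := vs _ v2y v2y'.
have DU : D <= (125 / 100 * y ^+ 2) * (125 / 100 * y ^+ 2).
  by apply: ler_pM; rewrite ?addr_ge0 ?sqr_ge0//; lra.
have ab : (u1 - t) * (u2 - t) <= 4 / 100 * y ^+ 2.
  by have := sqr_ge0 ((u1 - t) - (u2 - t)); rewrite sqrrB; lra.
(* The numerator is at least (81/100 - 4/100) y^4 and D is at most (5/4)^2 y^4; the ratio 0.4928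
   exceeds 9/20. *)
have : y ^+ 2 * (77 / 100 * y ^+ 2) <= y ^+ 2 * (v1 * v2 - (u1 - t) * (u2 - t)).
  by rewrite ler_pM2l//; lra.
by have := sqr_ge0 (y ^+ 2); lra.
Qed.

(* If G takes the same value at w1 != w2, the product of their two resolvents
   integrates to 0; but -y^2 times this product tends to 1 boundedly. *)
Lemma ray_transform_unique mu phi psi :
  ray_transform mu phi -> ray_transform mu psi -> \forall y \near +oo, phi y = psi y.
Proof.
move=> [phi1 phi2] [psi1 psi2].
have [T T0 mT] : exists2 T : R, 0 < T & ((9 / 10)%:E <= mu `[(- T)%R, T%R])%E.
  by apply: law_tight; lra.
have e0 : 0 < 10^-1 :> R by [].
have := phi2 _ e0; have := psi2 _ e0 => {}phi2 {}psi2.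
near=> y.
have [w1p G1] : 0 < Im (0 +i* y + phi y) /\
   cauchy_transform mu (0 +i* y + phi y) = (0 +i* y)^-1 by near: y.
have [w2p G2] : 0 < Im (0 +i* y + psi y) /\
   cauchy_transform mu (0 +i* y + psi y) = (0 +i* y)^-1 by near: y.
have [p1 p2] : `|Re (phi y)| <= 10^-1 * y /\ `|Im (phi y)| <= 10^-1 * y by near: y.
have [q1 q2] : `|Re (psi y)| <= 10^-1 * y /\ `|Im (psi y)| <= 10^-1 * y by near: y.
have y0 : 0 < y by near: y; exact: near_pinfty_gt.
have yT : T <= 10^-1 * y.
  by rewrite ler_pdivlMl//; near: y; exact: near_pinfty_ge.
set w1 := 0 +i* y + phi y in w1p G1; set w2 := 0 +i* y + psi y in w2p G2.
apply/eqP; apply: contraT => ne.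
have w21 : w2 - w1 != 0.
  by rewrite /w1 /w2 opprD addrACA subrr add0r subr_eq0 eq_sym.
pose h t := resolvent w1 t * resolvent w2 t.
have hE : h = fun t => (w2 - w1)^-1 * resolvent w1 t + (- (w2 - w1)^-1 * resolvent w2 t + 0).
  apply/funext => t; rewrite addr0 mulNr -mulrBr resolventB//.
  by rewrite mulKf.
have [I2 E2] := cint_lin (- (w2 - w1)^-1) (cintegrable_resolvent mu w2p) (cint_cst mu 0).1.
have [I1 E1] := cint_lin ((w2 - w1)^-1) (cintegrable_resolvent mu w1p) I2.
have h0 : cint mu h = 0.
  rewrite hE E1 E2 -!cauchy_transformE G1 G2 (cint_cst mu 0).2.
  by ring.
rewrite -hE in I1.
have Rh t : - (y ^+ 2 * Re (h t)) = y ^+ 2 * (Im w1 * Im w2 - (Re w1 - t) * (Re w2 - t))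
   / (((Re w1 - t) ^+ 2 + Im w1 ^+ 2) * ((Re w2 - t) ^+ 2 + Im w2 ^+ 2)).
  rewrite /h cReM !Re_resolvent !Im_resolvent invfM.
  by move: (_^-1) ((_ + Im w2 ^+ 2)^-1) => a b; ring.
have Rw1 : `|Re w1| <= 10^-1 * y by rewrite /w1 cReD add0r.
have Rw2 : `|Re w2| <= 10^-1 * y by rewrite /w2 cReD add0r.
have Iw1 : `|Im w1 - y| <= 10^-1 * y by rewrite /w1 cImD /= [y + _]addrC addrK.
have Iw2 : `|Im w2 - y| <= 10^-1 * y by rewrite /w2 cImD /= [y + _]addrC addrK.
have B t := resolvent_prod_bounds t y0 Rw1 Rw2 Iw1 Iw2.
(* The comparison function 17/10 1_F - 5/4 equals 9/20 on F and -5/4 elsewhere. As F has mass at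
   least 9/10, its integral is at least 1.53 - 1.25 > 0. *)
pose F : set (measurableTypeR R) := `[- T, T].
have mF : measurable F by exact: measurable_itv.
have IF := integrable_indic mu mF.
have IF' := @integrableZl _ _ _ mu _ measurableT (17 / 10) _ IF.
have Ic : mu.-integrable setT (EFin \o (fun=> - (5 / 4) : R)).
  exact: finite_measure_integrable_cst.
have L : \int[mu]_t (17 / 10 * \1_F t + - (5 / 4)) = 17 / 10 * fine (mu F) - 5 / 4.
  rewrite RintegralD// RintegralZl// Rintegral_cst// [X in fine X]probability_setT mulr1.
  by congr (_ * _ + _); rewrite /Rintegral integral_indic// setIT.
have Ih := @integrableZl _ _ _ mu _ measurableT (- y ^+ 2) _ I1.1.
have U : \int[mu]_t (- y ^+ 2 * Re (h t)) = 0.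
  by rewrite RintegralZl//; [have /= -> := congr1 (@complex.Re R) h0; rewrite mulr0|exact: I1.1].
have : \int[mu]_t (17 / 10 * \1_F t + - (5 / 4)) <= \int[mu]_t (- y ^+ 2 * Re (h t)).
  apply: le_Rintegral => //; first by have := integrableD measurableT IF' Ic; apply.
  move=> t _; rewrite mulNr Rh; have [_ [b1 b2]] := B t.
  rewrite indicE; case: (boolP (t \in F)) => tF /=; last by rewrite mulr0 add0r.
  have {}b2 := b2 _; move: tF; rewrite inE /F /= in_itv/= -ler_norml => tF.
  by move: (b2 (le_trans tF yT)); clear; lra.
rewrite L U.
have : 9 / 10 <= fine (mu F).
  by rewrite -lee_fin fineK// fin_num_measure.
by move: (fine _); clear => a; lra.
Unshelve. all: by end_near. Qed.

End ray.

(** * Free convolution powers on the imaginary axis *)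

Section free_power.
Context {R : realType}.
Local Open Scope classical_set_scope.
Local Open Scope complex_scope.
Local Notation C := R[i].
Local Notation Re := complex.Re.
Local Notation Im := complex.Im.
Local Notation law := (probability (measurableTypeR R) R).
Implicit Types (mu nu rho : law) (phi psi : R -> C).

Lemma eq_law_ray_transform mu nu phi :
  (forall A : set R, measurable (A : set (measurableTypeR R)) -> mu A = nu A) ->
  ray_transform mu phi -> ray_transform nu phi.
Proof.
move=> e [h1 h2]; split=> //; apply: filterS h1 => y [im G]; split=> //.
rewrite -G /cauchy_transform /Rintegral.
by congr (fine _ +i* fine _); apply: eq_measure_integral => A mA _; exact/esym/e.
Qed.

(** Each convolution in the power comes with its own cone and its own transforms.
    [ray_transform_unique] identifies them near infinity with the given ones, so that they add
    up. *)
Lemma free_power_ray_transform nu n rho phi psi : is_free_power nu n rho ->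
  ray_transform nu phi -> ray_transform rho psi ->
  \forall y \near +oo, psi y = n%:R * phi y.
Proof.
move=> np phiT; elim: np psi => {n rho} [rho e|n sigma rho _ IH conv] psi psiT.
  have psiT' : ray_transform nu psi by exact: eq_law_ray_transform psiT.
  by apply: filterS (ray_transform_unique psiT' phiT) => y ->; rewrite mul1r.
have [a [b [f [g [[a0 _] fT gT fgT]]]]] := conv.
have := IH _ (is_voiculescu_transform_ray a0 fT).
have := ray_transform_unique phiT (is_voiculescu_transform_ray a0 gT).
have := ray_transform_unique psiT (is_voiculescu_transform_ray a0 fgT).
apply: filterS3 => y -> -> ->.
by rewrite -natr1 mulrDl mul1r.
Qed.

(** For n = 1 a free power is mere equality of laws and supplies no transform; from n = 2 on, the
    last convolution supplies one for [nu] and one for [rho]. *)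
Lemma free_power_ray_transform_ex nu n rho : (1 < n)%N -> is_free_power nu n rho ->
  exists phi psi : R -> C, [/\ ray_transform nu phi, ray_transform rho psi
    & \forall y \near +oo, psi y = n%:R * phi y].
Proof.
move=> + np; case: np => {n rho} [//|n sigma rho np conv _].
have [a [b [f [g [[a0 _] fT gT fgT]]]]] := conv.
have gT' := is_voiculescu_transform_ray a0 gT.
have fgT' := is_voiculescu_transform_ray a0 fgT.
do 2 eexists; split; [exact: gT'|exact: fgT'|].
exact: free_power_ray_transform (free_powerS np conv) gT' fgT'.
Qed.

End free_power.

(** * Positivity of the Gram matrix of centered resolvents *)

Section pick.
Context {R : realType}.
Local Open Scope complex_scope.
Local Notation C := R[i].
Local Notation Re := complex.Re.
Local Notation Im := complex.Im.
Local Notation law := (probability (measurableTypeR R) R).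
Local Notation cj := (@conjc R).
Implicit Types (mu : law) (f : R -> C) (w z : C).

Let cjB z w : cj (z - w) = cj z - cj w.
Proof. by case: z => a b; case: w => c d; apply: complex_ext; rewrite /= ?opprD. Qed.

Let cjM z w : cj (z * w) = cj z * cj w.
Proof. by case: z => a b; case: w => c d; apply: complex_ext; rewrite /=; ring. Qed.

Let cjV z : cj z^-1 = (cj z)^-1.
Proof. by case: z => a b; apply: complex_ext; rewrite /= sqrrN ?mulNr. Qed.

Let cjR (x : R) : cj x%:C = x%:C.
Proof. by apply: complex_ext; rewrite /= ?oppr0. Qed.

Let cjK z : cj (cj z) = z.
Proof. by case: z => a b; apply: complex_ext; rewrite /= ?opprK. Qed.

Let cj1 : cj 1 = 1. Proof. exact: cjR. Qed.

Let cj_eq0 z : (cj z == 0) = (z == 0).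
Proof. by case: z => a b; rewrite !eq_complex /= oppr_eq0. Qed.

Lemma cint_conj mu f : cintegrable mu f ->
  cintegrable mu (fun t => cj (f t)) /\ cint mu (fun t => cj (f t)) = cj (cint mu f).
Proof.
move=> [If1 If2].
have J := @integrableZl _ _ _ mu _ measurableT (- 1) _ If2.
have e1 t : Re (cj (f t)) = Re (f t) by case: (f t).
have e2 t : Im (cj (f t)) = - 1 * Im (f t) by case: (f t) => a b /=; rewrite mulN1r.
split.
  by split; [under eq_fun do rewrite /= e1|under eq_fun do rewrite /= e2].
apply: complex_ext; rewrite /cint /=.
  by under eq_Rintegral do rewrite e1.
by under eq_Rintegral do rewrite e2; rewrite RintegralZl// mulN1r.
Qed.

Lemma conj_sub_neq0 w w' : 0 < Im w -> 0 < Im w' -> cj w' - w != 0.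
Proof.
case: w => u v; case: w' => u' v' /= v0 v0'; apply/eqP => -[_] e.
by move: (addr_gt0 v0 v0'); rewrite addrC -oppr_lt0 opprD e ltxx.
Qed.

(* The functions z / (w - t) - 1 with z = F_mu w are centered, and their Gram
   matrix is explicit. *)
Lemma cint_centered_resolvents mu w z w' z' :
  0 < Im w -> 0 < Im w' -> z != 0 -> z' != 0 ->
  cauchy_transform mu w = z^-1 -> cauchy_transform mu w' = z'^-1 ->
  let h t := (z * resolvent w t - 1) * cj (z' * resolvent w' t - 1) in
  cintegrable mu h /\ cint mu h = (cj z' - z) / (cj w' - w) - 1.
Proof.
move=> w0 w0' z0 z0' G G' h.
have ww := conj_sub_neq0 w0 w0'.
(* The partial fraction coefficient: z cj(z') / ((w - t) (cj(w') - t)) is A times the difference of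
   1 / (w - t) and 1 / (cj(w') - t). *)
pose A := z * cj z' / (cj w' - w).
have [I1 E1] := cint_conj (cintegrable_resolvent mu w0').
have [I2 E2] := cint_lin (- A - cj z') I1 (cint_cst mu 1).1.
have [I3 E3] := cint_lin (A - z) (cintegrable_resolvent mu w0) I2.
have hE : h = fun t => (A - z) * resolvent w t +
    ((- A - cj z') * cj (resolvent w' t) + 1).
  apply/funext => t; rewrite /h /A cjB cjM cj1.
  have -> : cj (resolvent w' t) = (cj w' - t%:C)^-1.
    by rewrite /resolvent cjV cjB cjR.
  have d1 := sub_real_neq0 t w0.
  have d2 : cj w' - t%:C != 0.
    by rewrite -(cjR t) -cjB cj_eq0 sub_real_neq0.
  rewrite /resolvent; field.
  by rewrite d1 d2 ww.
rewrite hE; split=> //.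
have z0c : cj z' != 0 by rewrite cj_eq0.
rewrite E3 E2 E1 (cint_cst mu 1).2 -!cauchy_transformE G G' cjV /A.
by field; rewrite z0 z0c ww.
Qed.

(* The Gram form of the two centered resolvents at the coefficients (H22, - H12)
   is H22 times the Gram determinant. *)
Lemma pick_inequality mu (y1 y2 : R) w1 w2 : 0 < y1 -> 0 < y2 ->
  0 < Im w1 -> 0 < Im w2 ->
  cauchy_transform mu w1 = (0 +i* y1)^-1 -> cauchy_transform mu w2 = (0 +i* y2)^-1 ->
  let v1 := Im w1 in let v2 := Im w2 in let d := Re w1 - Re w2 in
  let r1 := y1 - v1 in let r2 := y2 - v2 in 0 < r2 ->
  0 <= (r1 * v1 - r2 * v2) * (r2 * v1 - r1 * v2) + d ^+ 2 * (r1 * r2 - v1 * v2).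
Proof.
move=> y10 y20 v10 v20 G1 G2 v1 v2 d r1 r2 r20.
have neq0 y : 0 < y -> 0 +i* y != 0 :> C.
  by move=> y0; apply/eqP => -[] e; rewrite e ltxx in y0.
have z10 := neq0 _ y10; have z20 := neq0 _ y20.
have [I11 E11] := cint_centered_resolvents v10 v10 z10 z10 G1 G1.
have [I12 E12] := cint_centered_resolvents v10 v20 z10 z20 G1 G2.
have [I21 E21] := cint_centered_resolvents v20 v10 z20 z10 G2 G1.
have [I22 E22] := cint_centered_resolvents v20 v20 z20 z20 G2 G2.
set H11 := _ - 1 in E11; set H12 := _ - 1 in E12; set H21 := _ - 1 in E21.
set H22 := _ - 1 in E22.
have H21E : H21 = cj H12.
  rewrite /H21 /H12 cjB cjM cjV !cjB cj1 !cjK.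
  by rewrite -[w2 - _]opprB -[(0 +i* y2) - _]opprB invrN mulrNN.
have Hd y (w : C) : 0 < Im w -> (cj (0 +i* y) - (0 +i* y)) / (cj w - w) - 1 =
    ((y - Im w) / Im w)%:C.
  case: w => u v /= v0.
  have -> : (0 -i* y) - (0 +i* y) = (- 2 * 'i) * y%:C.
    by apply: complex_ext; rewrite /=; ring.
  have -> : (u -i* v) - (u +i* v) = (- 2 * 'i) * v%:C.
    by apply: complex_ext; rewrite /=; ring.
  have v0' : v%:C != 0 by apply/eqP => -[] e; rewrite e ltxx in v0.
  have i0 : 'i != 0 :> C by apply/eqP => -[] /eqP; rewrite oner_eq0.
  rewrite rmorphM rmorphB fmorphV/=.
  by field; rewrite v0' i0.
have H11E : H11 = (r1 / v1)%:C by exact: Hd.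
have H22E : H22 = (r2 / v2)%:C by exact: Hd.
pose q t := H22 * ((0 +i* y1) * resolvent w1 t - 1) - H12 * ((0 +i* y2) * resolvent w2 t - 1).
have [_ J0] := cint_cst mu 0.
have [K1 F1] := cint_lin (H12 * cj H12) I22 (cint_cst mu 0).1.
have [K2 F2] := cint_lin (- (H12 * cj H22)) I21 K1.
have [K3 F3] := cint_lin (- (H22 * cj H12)) I12 K2.
have [K4 F4] := cint_lin (H22 * cj H22) I11 K3.
have : 0 <= Re (cint mu (fun t => q t * cj (q t))).
  rewrite /cint /=; apply: Rintegral_ge0 => t _.
  by case: (q t) => a b /=; rewrite mulrN opprK addr_ge0// -expr2 sqr_ge0.
have -> : (fun t => q t * cj (q t)) = fun t =>
    H22 * cj H22 * (((0 +i* y1) * resolvent w1 t - 1) * cj ((0 +i* y1) * resolvent w1 t - 1)) +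
    (- (H22 * cj H12) * (((0 +i* y1) * resolvent w1 t - 1) * cj ((0 +i* y2) * resolvent w2 t - 1)) +
    (- (H12 * cj H22) * (((0 +i* y2) * resolvent w2 t - 1) * cj ((0 +i* y1) * resolvent w1 t - 1)) +
    (H12 * cj H12 * (((0 +i* y2) * resolvent w2 t - 1) * cj ((0 +i* y2) * resolvent w2 t - 1)) + 0))).
  apply/funext => t; rewrite /q.
  move: (_ - 1) (_ - 1) => a b.
  by rewrite cjB !cjM; ring.
rewrite F4 F3 F2 F1 (cint_cst mu 0).2 E11 E12 E21 E22 H21E H22E H11E cjR.
set a := r2 / v2; set b := r1 / v1.
rewrite (_ : Re _ = a * (a * b - (Re H12 ^+ 2 + Im H12 ^+ 2))); last first.
  by case: (H12) => x y /=; ring.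
have HW : H12 * (cj w2 - w1) = d +i* - (r1 + r2).
  rewrite /H12 mulrBl mul1r divfK ?conj_sub_neq0//.
  rewrite /d /r1 /r2 /v1 /v2; case: (w1) => ? ?; case: (w2) => ? ?.
  by apply: complex_ext; rewrite /=; ring.
have W0 : 0 < d ^+ 2 + (v1 + v2) ^+ 2 by rewrite ltr_wpDl ?sqr_ge0// exprn_gt0// addr_gt0.
(* Squared moduli in [HW] express |H12|^2 through real quantities. *)
have NW : (Re H12 ^+ 2 + Im H12 ^+ 2) * (d ^+ 2 + (v1 + v2) ^+ 2) = d ^+ 2 + (r1 + r2) ^+ 2.
  have cwE : cj w2 - w1 = (- d) +i* (- (v1 + v2)).
    rewrite /d /v1 /v2; case: (w1) => ? ?; case: (w2) => ? ?.
    by apply: complex_ext; rewrite /=; ring.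
  have := congr1 (@complex.Re R) HW; have := congr1 (@complex.Im R) HW.
  rewrite cwE; case: (H12) => x y /= e1 e2.
  transitivity ((x * - d - y * - (v1 + v2)) ^+ 2 + (x * - (v1 + v2) + y * - d) ^+ 2).
    by ring.
  by rewrite e2 e1 sqrrN.
move: (Re H12 ^+ 2 + _) NW => M NW.
have a0 : 0 < a by rewrite divr_gt0.
rewrite pmulr_rge0// subr_ge0 => Mab.
have : M * (d ^+ 2 + (v1 + v2) ^+ 2) <= a * b * (d ^+ 2 + (v1 + v2) ^+ 2).
  by rewrite ler_wpM2r// ltW.
rewrite NW /a /b mulf_div mulrAC ler_pdivlMr ?mulr_gt0// -subr_ge0.
(* With denominators cleared, the terms 2 r1 r2 v1 v2 cancel and the part without d factors. *)
by congr (0 <= _); ring.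
Qed.

End pick.

(** * Expansion of the Voiculescu transform at infinity *)
Section expansion.
Context {R : realType}.
Local Open Scope classical_set_scope.
Local Open Scope complex_scope.
Local Notation C := R[i].
Local Notation Re := complex.Re.
Local Notation Im := complex.Im.
Local Notation law := (probability (measurableTypeR R) R).
Implicit Types (mu : law) (f g : R -> C) (phi : R -> C).

Definition bounded_at_oo f : Prop := exists M : R, \forall y \near +oo, `|f y| <= M%:C.

Definition vanishing_at_oo f : Prop :=
  forall e : R, 0 < e -> \forall y \near +oo, `|f y| <= e%:C.

Lemma vanishing_bounded f : vanishing_at_oo f -> bounded_at_oo f.
Proof. by move=> /(_ 1 ltr01) ?; exists 1. Qed.

Lemma bounded_at_oo_cst (c : C) : bounded_at_oo (fun=> c).
Proof. by exists (complex.Re `|c|); apply: nearW => y; rewrite RRe_real ?normr_real. Qed.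

Lemma bounded_at_ooD f g : bounded_at_oo f -> bounded_at_oo g ->
  bounded_at_oo (fun y => f y + g y).
Proof.
move=> [M fM] [N gN]; exists (M + N); apply: filterS2 fM gN => y fM gN.
by rewrite rmorphD/= (le_trans (ler_normD _ _))// lerD.
Qed.

Lemma bounded_at_ooM f g : bounded_at_oo f -> bounded_at_oo g ->
  bounded_at_oo (fun y => f y * g y).
Proof.
move=> [M fM] [N gN]; exists (M * N); apply: filterS2 fM gN => y fM gN.
by rewrite rmorphM/= normrM ler_pM.
Qed.

Lemma bounded_at_ooX f n : bounded_at_oo f -> bounded_at_oo (fun y => f y ^+ n).
Proof.
move=> bf; elim: n => [|n IH]; first exact: bounded_at_oo_cst.
by under eq_fun do rewrite exprS; exact: bounded_at_ooM.
Qed.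

Lemma bounded_at_ooN f : bounded_at_oo f -> bounded_at_oo (fun y => - f y).
Proof. by move=> [M fM]; exists M; apply: filterS fM => y; rewrite normrN. Qed.

Lemma bounded_at_ooB f g : bounded_at_oo f -> bounded_at_oo g ->
  bounded_at_oo (fun y => f y - g y).
Proof. by move=> bf bg; apply: bounded_at_ooD => //; exact: bounded_at_ooN. Qed.

Lemma vanishingMr f g : vanishing_at_oo f -> bounded_at_oo g ->
  vanishing_at_oo (fun y => f y * g y).
Proof.
move=> f0 [M gM] e e0.
have M0 : 0 < `|M| + 1 by rewrite ltr_wpDl.
have := f0 (e / (`|M| + 1)); rewrite divr_gt0// => /(_ isT) {}f0.
apply: filterS2 f0 gM => y fy gy.
rewrite normrM -(divfK (lt0r_neq0 M0) e) rmorphM/= ler_pM//.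
apply: (le_trans gy); rewrite lecR.
by rewrite (le_trans (ler_norm _))// lerDl.
Qed.

Lemma bounded_at_ooV1 f : vanishing_at_oo f -> bounded_at_oo (fun y => (1 + f y)^-1).
Proof.
move=> f0; exists 2; have := f0 (2^-1); rewrite invr_gt0 ltr0n => /(_ isT).
apply: filterS => y fy.
have h : (2^-1)%:C <= `|1 + f y|.
  have : `|1 : C| - `|- f y| <= `|1 - (- f y)| by exact: lerB_dist.
  rewrite opprK normr1 normrN; apply: le_trans.
  rewrite lerBrDr -lerBrDl; apply: (le_trans fy).
  by rewrite -(rmorph1 (real_complex R)) -rmorphB lecR; lra.
have h0 : 0 < (2^-1)%:C :> C by rewrite ltcR invr_gt0.
have -> : 2%:C = ((2^-1)%:C)^-1 :> C by rewrite -fmorphV invrK.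
by rewrite normfV lef_pV2 ?posrE// (lt_le_trans h0).
Qed.

Lemma Rintegral_ae_bounded mu (f : R -> R) (M : R) :
  0 <= M -> mu.-integrable setT (EFin \o f) -> {ae mu, forall t, `|f t| <= M} ->
  `|\int[mu]_t f t| <= M.
Proof.
move=> M0 If fM; apply: (le_trans (le_normr_Rintegral measurableT If)).
rewrite -lee_fin /Rintegral fineK; last first.
  by apply: integrable_fin_num => //; exact: integrable_norm.
apply: (@le_trans _ _ (\int[mu]_(t in setT) (cst M%:E t))%E).
  apply: ae_ge0_le_integral => //.
  - by move/measurable_int : If => /measurable_EFinP mf; apply/measurable_EFinP; exact: measurableT_comp.
  - apply: (@filterS _ _ (ae_filter_ringOfSetsType mu) _ _ _ fM) => t H _.
    by rewrite lee_fin.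
by rewrite integral_cst// [X in (_ * X)%E]probability_setT mule1.
Qed.

Lemma cint_ae_bounded mu f (M : R) : 0 <= M -> cintegrable mu f ->
  {ae mu, forall t, `|f t| <= M%:C} -> `|cint mu f| <= (2 * M)%:C.
Proof.
move=> M0 [If1 If2] fM.
have F1 : `|Re (cint mu f)| <= M.
  apply: Rintegral_ae_bounded => //.
  by apply: (@filterS _ _ (ae_filter_ringOfSetsType mu) _ _ _ fM) => t /normc_ge_ReIm[].
have F2 : `|Im (cint mu f)| <= M.
  apply: Rintegral_ae_bounded => //.
  by apply: (@filterS _ _ (ae_filter_ringOfSetsType mu) _ _ _ fM) => t /normc_ge_ReIm[].
case: (cint mu f) F1 F2 => a b /= F1 F2.
rewrite normc_def lecR -(ger0_norm (mulr_ge0 (ler0n R 2) M0)) -sqrtr_sqr ler_wsqrtr//=.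
move: F1 F2; rewrite !ler_norml => /andP[? ?] /andP[? ?]; nra.
Qed.

Lemma cint_real_power mu (c K : R) n : {ae mu, forall t, `|t - c| <= K} ->
  cintegrable mu (fun t => (t%:C - c%:C) ^+ n) /\
  cint mu (fun t => (t%:C - c%:C) ^+ n) = (\int[mu]_t (t - c) ^+ n)%:C.
Proof.
move=> tK.
have e1 t : Re ((t%:C - c%:C) ^+ n) = (t - c) ^+ n by rewrite -rmorphB -rmorphXn.
have e2 t : Im ((t%:C - c%:C) ^+ n) = 0 by rewrite -rmorphB -rmorphXn.
split.
  split; last first.
    under eq_fun do rewrite /= e2.
    exact: finite_measure_integrable_cst.
  under eq_fun do rewrite /= e1.
  apply: (@integrable_bounded _ _ _ (`|K| ^+ n)).
    apply: measurable_funX; exact: measurable_funB.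
  apply: (@filterS _ _ (ae_filter_ringOfSetsType mu) _ _ _ tK) => t H.
  by rewrite normrX lerXn2r ?nnegrE// (le_trans H) ?ler_norm.
apply: complex_ext; rewrite /cint/=.
  by under eq_Rintegral do rewrite e1.
by under eq_Rintegral do rewrite e2; rewrite Rintegral_cst// mul0r.
Qed.

End expansion.
Section voiculescu_expansion.
Context {R : realType}.
Local Open Scope classical_set_scope.
Local Open Scope complex_scope.
Local Notation C := R[i].
Local Notation Re := complex.Re.
Local Notation Im := complex.Im.
Local Notation law := (probability (measurableTypeR R) R).
Variables (mu : law) (c K : R).
Hypotheses (K0 : 0 <= K) (muK : {ae mu, forall t, `|t - c| <= K}).
Hypothesis (mean : \int[mu]_t (t - c) = 0).
Local Notation m k := (\int[mu]_t (t - c) ^+ k).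

(* With tau = t - c, the left-hand side integrates the tail
   d tau^5 / (d - tau) of the geometric series for d^6 / (d - tau). *)
Lemma cauchy_transform_expansion (w d : C) : 0 < Im w -> d = w - c%:C -> (2 * K)%:C <= `|d| ->
  `|d ^+ 6 * cauchy_transform mu w - d ^+ 5 - d ^+ 3 * (m 2)%:C - d ^+ 2 * (m 3)%:C
    - d * (m 4)%:C| <= (2 * (2 * K ^+ 5))%:C.
Proof.
move=> w0 dE wK.
pose tau (t : R) : C := t%:C - c%:C.
have [J0 E0] := cint_cst mu 0.
have [J1 E1] := cint_lin (- d) (cint_real_power 4 muK).1 J0.
have [J2 E2] := cint_lin (- d ^+ 2) (cint_real_power 3 muK).1 J1.
have [J3 E3] := cint_lin (- d ^+ 3) (cint_real_power 2 muK).1 J2.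
have [J4 E4] := cint_lin (- d ^+ 4) (cint_real_power 1 muK).1 J3.
have [J5 E5] := cint_lin (- d ^+ 5) (cint_cst mu 1).1 J4.
have [J6 E6] := cint_lin (d ^+ 6) (cintegrable_resolvent mu w0) J5.
set S := (fun t => d ^+ 6 * _ + _) in J6 E6.
have -> : d ^+ 6 * cauchy_transform mu w - d ^+ 5 - d ^+ 3 * (m 2)%:C - d ^+ 2 * (m 3)%:C
    - d * (m 4)%:C = cint mu S.
  rewrite E6 E5 E4 E3 E2 E1 E0 (cint_cst mu 1).2 -cauchy_transformE.
  rewrite !(cint_real_power _ muK).2.
  under [m 1]eq_Rintegral do rewrite expr1.
  rewrite mean; ring.
apply: cint_ae_bounded J6 _; first by rewrite mulr_ge0// exprn_ge0.
apply: (@filterS _ _ (ae_filter_ringOfSetsType mu) _ _ _ muK) => t tK.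
have wt := sub_real_neq0 t w0.
have dt : d - tau t = w - t%:C by rewrite dE /tau; ring.
have -> : S t = tau t ^+ 5 * (d / (d - tau t)).
  rewrite /S -/(tau t) /resolvent -dt; field.
  by rewrite dt.
have ntau : `|tau t| = `|t - c|%:C by rewrite /tau -rmorphB normc_def /= expr0n addr0 sqrtr_sqr.
(* For K = 0 the hypothesis 2K <= |d| gives no positive lower bound, but then tau vanishes and the
   tail with it. *)
have [K00|K00] := eqVneq K 0.
  have : tau t = 0.
    by apply/normr0_eq0; rewrite ntau; congr _%:C; apply/eqP; rewrite eq_le normr_ge0 -[leRHS]K00 tK.
  by move=> ->; rewrite expr0n mul0r normr0 ler0c mulr_ge0// exprn_ge0.
have Kp : 0 < K by rewrite lt_neqAle eq_sym K00.
have dn : 0 < `|d| by apply: lt_le_trans wK; rewrite ltcR mulr_gt0.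
(* As |tau| <= K <= |d| / 2, the factor d / (d - tau) has modulus at most 2. *)
have h : `|d| / 2 <= `|d - tau t|.
  apply: le_trans (lerB_dist _ _); rewrite lerBrDr -lerBrDl.
  rewrite ntau; apply: (@le_trans _ _ K%:C); first by rewrite lecR.
  rewrite (_ : `|d| - `|d| / 2 = `|d| / 2); last by field.
  rewrite ler_pdivlMr// mulrC; apply: le_trans wK.
  by rewrite rmorphM/= rmorph_nat.
rewrite normrM normrX ntau [in leRHS]mulrC rmorphM/=; apply: ler_pM.
- by rewrite -rmorphXn /= ler0c exprn_ge0.
- exact: normr_ge0.
  by rewrite -rmorphXn/= lecR lerXn2r ?nnegrE.
rewrite normrM normfV ler_pdivrMr; last first.
  by rewrite normr_gt0 dt.
have e : 2%:C * (`|d| / 2) = `|d| by rewrite rmorph_nat; field.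
by rewrite -[leLHS]e ler_wpM2l// ler0c.
Qed.

End voiculescu_expansion.

(* Reversion of the series e (1 + x) = G w in e = 1 / (w - a); s e^6 is the
   remainder of the fourth-order expansion of G. *)
Lemma voiculescu_series_identity (F : fieldType) (a c2 c3 c4 e s : F) :
  let r := c2 + c3 * e + c4 * e ^+ 2 + s * e ^+ 3 in
  let x := e * (e * r) in let k4 := c4 - 2 * c2 ^+ 2 in
  e != 0 -> 1 + x != 0 ->
  a + e^-1 - (e * (1 + x))^-1 = a + c2 * (e * (1 + x)) + c3 * (e * (1 + x)) ^+ 2
    + k4 * (e * (1 + x)) ^+ 3 + (e * (1 + x)) ^+ 4 *
    ((s - 2 * c2 * (c3 + c4 * e + s * e ^+ 2) - c2 * (e * r ^+ 2)
     - c3 * (r * (3 + 3 * x + x ^+ 2)) - k4 * (e * (r * (4 + 6 * x + 4 * x ^+ 2 + x ^+ 3))))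
     * (1 + x)^-1 ^+ 5).
Proof.
move=> r x k4 e0 g0; set Q := s - _ - _ - _ - _.
have P : e * r = c2 * e * (1 + x) ^+ 2 + c3 * e ^+ 2 * (1 + x) ^+ 3
    + k4 * e ^+ 3 * (1 + x) ^+ 4 + e ^+ 4 * Q.
  apply/eqP; rewrite -subr_eq0; apply/eqP.
  (* With r kept as an unknown, Q absorbs the higher powers of x, and the two sides differ by a
     multiple of r minus its definition. *)
  transitivity (e * (1 - 2 * c2 * e ^+ 2) *
      (r - (c2 + c3 * e + c4 * e ^+ 2 + s * e ^+ 3))).
    by rewrite /Q /k4 /x; ring.
  by rewrite subrr mulr0.
transitivity (a + e * r / (1 + x)).
  by rewrite -addrA; congr (_ + _); move: g0; rewrite /x => g0; field; rewrite e0 g0.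
rewrite P; field; by rewrite g0.
Qed.

Section voiculescu_ray.
Context {R : realType}.
Local Open Scope classical_set_scope.
Local Open Scope complex_scope.
Local Notation C := R[i].
Local Notation Re := complex.Re.
Local Notation Im := complex.Im.
Local Notation law := (probability (measurableTypeR R) R).
Variables (mu : law) (c K : R).
Hypotheses (K0 : 0 <= K) (muK : {ae mu, forall t, `|t - c| <= K}).
Hypothesis (mean : \int[mu]_t (t - c) = 0).
Local Notation m k := (\int[mu]_t (t - c) ^+ k).

(** For w = iy + phi y and e = 1 / (w - c), the expansion of G reads 1 / (iy) = e (1 + x) with x =
    o(1). [voiculescu_series_identity] solves it for w; the remainder is a polynomial in bounded
    functions times (1 + x)^-5, hence bounded. *)
Lemma ray_transform_expansion (phi : R -> C) : ray_transform mu phi ->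
  exists2 b : R -> C, bounded_at_oo b &
  \forall y \near +oo, let z := (0 +i* y)^-1 in
    phi y = c%:C + (m 2)%:C * z + (m 3)%:C * z ^+ 2
      + (m 4 - 2 * m 2 ^+ 2)%:C * z ^+ 3 + z ^+ 4 * b y.
Proof.
move=> [phi1 phi2].
pose d y := 0 +i* y + phi y - c%:C; pose e y := (d y)^-1.
have dlb : \forall y \near +oo, (y / 2)%:C <= `|d y|.
  have h2 : 0 < 2^-1 :> R by rewrite invr_gt0.
  have := phi2 _ h2; apply: filterS => y [_].
  rewrite ler_norml => /andP[h _].
  apply: le_trans (le_Im_normc _); rewrite lecR.
  apply: le_trans (ler_norm _).
  by rewrite /d !cImD cImN /= subr0; lra.
have e0 : vanishing_at_oo e.
  move=> r r0; near=> y.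
  have y0 : 0 < y by near: y; exact: near_pinfty_gt.
  have dy : (y / 2)%:C <= `|d y| by near: y.
  have yr : r^-1 * 2 <= y by near: y; exact: near_pinfty_ge.
  have d0 : 0 < `|d y| by apply: lt_le_trans dy; rewrite ltcR divr_gt0.
  rewrite normfV -[leRHS]invrK lef_pV2 ?posrE//; last by rewrite invr_gt0 ltcR.
  by rewrite -fmorphV; apply: le_trans dy; rewrite lecR ler_pdivlMr.
pose z y : C := (0 +i* y)^-1.
pose s y := d y ^+ 6 * z y - d y ^+ 5 - d y ^+ 3 * (m 2)%:C - d y ^+ 2 * (m 3)%:C
    - d y * (m 4)%:C.
have bs : bounded_at_oo s.
  exists (2 * (2 * K ^+ 5)); near=> y.
  have [w0 G] : 0 < Im (0 +i* y + phi y) /\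
     cauchy_transform mu (0 +i* y + phi y) = (0 +i* y)^-1 by near: y.
  have dy : (y / 2)%:C <= `|d y| by near: y.
  have yK : 2 * K * 2 <= y by near: y; exact: near_pinfty_ge.
  rewrite /s /z -G; apply: cauchy_transform_expansion => //.
  by apply: le_trans dy; rewrite lecR ler_pdivlMr.
have be := vanishing_bounded e0.
have cst := @bounded_at_oo_cst R.
pose r y := (m 2)%:C + (m 3)%:C * e y + (m 4)%:C * e y ^+ 2 + s y * e y ^+ 3.
have br : bounded_at_oo r.
  apply: bounded_at_ooD (bounded_at_ooM bs (bounded_at_ooX 3 be)).
  apply: bounded_at_ooD (bounded_at_ooM (cst _) (bounded_at_ooX 2 be)).
  exact: bounded_at_ooD (cst _) (bounded_at_ooM (cst _) be).
pose x y := e y * (e y * r y).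
have x0 : vanishing_at_oo x by apply: vanishingMr => //; exact: bounded_at_ooM.
have bx := vanishing_bounded x0.
have bg := bounded_at_ooV1 x0.
pose k4 : C := (m 4 - 2 * m 2 ^+ 2)%:C.
pose Q y := s y - 2 * (m 2)%:C * ((m 3)%:C + (m 4)%:C * e y + s y * e y ^+ 2)
  - (m 2)%:C * (e y * r y ^+ 2) - (m 3)%:C * (r y * (3 + 3 * x y + x y ^+ 2))
  - k4 * (e y * (r y * (4 + 6 * x y + 4 * x y ^+ 2 + x y ^+ 3))).
exists (fun y => Q y * (1 + x y)^-1 ^+ 5).
  apply: bounded_at_ooM (bounded_at_ooX 5 bg).
  have bR3 : bounded_at_oo (fun y => 3 + 3 * x y + x y ^+ 2).
    exact: bounded_at_ooD (bounded_at_ooD (cst 3) (bounded_at_ooM (cst 3) bx))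
      (bounded_at_ooX 2 bx).
  have bR4 : bounded_at_oo (fun y => 4 + 6 * x y + 4 * x y ^+ 2 + x y ^+ 3).
    apply: bounded_at_ooD (bounded_at_ooX 3 bx).
    apply: bounded_at_ooD (bounded_at_ooM (cst 4) (bounded_at_ooX 2 bx)).
    exact: bounded_at_ooD (cst 4) (bounded_at_ooM (cst 6) bx).
  have bQ2 : bounded_at_oo (fun y => (m 3)%:C + (m 4)%:C * e y + s y * e y ^+ 2).
    apply: bounded_at_ooD (bounded_at_ooM bs (bounded_at_ooX 2 be)).
    exact: bounded_at_ooD (cst _) (bounded_at_ooM (cst _) be).
  apply: bounded_at_ooB (bounded_at_ooM (cst k4) (bounded_at_ooM be (bounded_at_ooM br bR4))).
  apply: bounded_at_ooB (bounded_at_ooM (cst _) (bounded_at_ooM br bR3)).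
  apply: bounded_at_ooB (bounded_at_ooM (cst _) (bounded_at_ooM be (bounded_at_ooX 2 br))).
  exact: bounded_at_ooB bs (bounded_at_ooM (cst _) bQ2).
near=> y.
have y0 : 0 < y by near: y; exact: near_pinfty_gt.
have dy : (y / 2)%:C <= `|d y| by near: y.
have d0 : d y != 0.
  by rewrite -normr_gt0; apply: lt_le_trans dy; rewrite ltcR divr_gt0.
have iy0 : 0 +i* y != 0 :> C by apply/eqP => -[] yy; rewrite yy ltxx in y0.
have gE : 1 + x y = d y * z y.
  by rewrite /x /r /s /e; field.
have z0 : z y != 0 by rewrite invr_neq0.
have g0 : 1 + x y != 0 by rewrite gE mulf_neq0.
have phiE : phi y = c%:C + (e y)^-1 - (z y)^-1 by rewrite /e /z !invrK /d; ring.
have zE : z y = e y * (1 + x y) by rewrite gE mulKf.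
have k4E : k4 = (m 4)%:C - 2 * (m 2)%:C ^+ 2.
  by rewrite /k4 rmorphB rmorphM rmorphXn rmorph_nat.
rewrite /= -/(z y) -/k4 phiE zE /Q k4E; apply: voiculescu_series_identity => //.
by rewrite invr_neq0.
Unshelve. all: by end_near. Qed.

End voiculescu_ray.

(** * Free infinite divisibility *)
Section free_divisibility.
Context {R : realType}.
Local Open Scope classical_set_scope.
Local Open Scope complex_scope.
Local Notation C := R[i].
Local Notation Re := complex.Re.
Local Notation Im := complex.Im.
Local Notation law := (probability (measurableTypeR R) R).
Variables (mu : law) (c K : R).
Hypotheses (K0 : 0 <= K) (muK : {ae mu, forall t, `|t - c| <= K}).
Hypothesis (mean : \int[mu]_t (t - c) = 0).
Local Notation m k := (\int[mu]_t (t - c) ^+ k).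

(** Powers of 1 / (iy) alternate between real and imaginary, so the second and fourth cumulants
    appear in Im and the first and third in Re. *)
Lemma ray_transform_real_expansion (phi : R -> C) : ray_transform mu phi ->
  exists M : R, \forall y \near +oo,
    `|- Im (phi y) * y - m 2 + (m 4 - 2 * m 2 ^+ 2) / y ^+ 2| <= M / y ^+ 3 /\
    `|Re (phi y) - c + m 3 / y ^+ 2| <= M / y ^+ 3.
Proof.
move=> /(ray_transform_expansion K0 muK mean)[b [M bM] phiE].
exists M; near=> y.
have y1 : 1 <= y by near: y; exact: near_pinfty_ge.
have y0 : 0 < y by apply: lt_le_trans y1.
have [b1 b2] : `|Re (b y)| <= M /\ `|Im (b y)| <= M.
  by apply: normc_ge_ReIm; near: y.
have M0 : 0 <= M by apply: le_trans b1.
have -> : phi y = c%:C + (m 2)%:C * (0 +i* y)^-1 + (m 3)%:C * (0 +i* y)^-1 ^+ 2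
      + (m 4 - 2 * m 2 ^+ 2)%:C * (0 +i* y)^-1 ^+ 3 + (0 +i* y)^-1 ^+ 4 * b y by near: y.
move: (m 2) (m 3) (m 4 - 2 * m 2 ^+ 2) => k2 k3 k4.
have zE : (0 +i* y)^-1 = 0 +i* - y^-1 :> C.
  by apply: complex_ext; rewrite ?cReV ?cImV /= ?mul0r// expr0n add0r; field; rewrite gt_eqF.
rewrite zE; case: (b y) b1 b2 => b1 b2 B1 B2; rewrite /= in B1 B2.
have y00 : y != 0 by rewrite gt_eqF.
set w := (X in Re X).
have -> : Re w = c - k3 / y ^+ 2 + b1 / y ^+ 4.
  by rewrite /w !exprS !expr0 /=; field.
have -> : Im w = - k2 / y + k4 / y ^+ 3 + b2 / y ^+ 4.
  by rewrite /w !exprS !expr0 /=; field.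
have y3 : 0 < y ^+ 3 by rewrite exprn_gt0.
split.
  rewrite (_ : _ - _ + _ = - (b2 / y ^+ 3)); last by field.
  by rewrite normrN normrM normfV (gtr0_norm y3) ler_pM2r ?invr_gt0.
rewrite (_ : _ - _ + _ = b1 / y ^+ 4); last by field.
rewrite normrM normfV (gtr0_norm (exprn_gt0 4 y0)).
apply: ler_pM => //; rewrite ?invr_ge0 ?exprn_ge0 ?(ltW y0)//.
by rewrite lef_pV2 ?posrE ?exprn_gt0// ler_weXn2l.
Unshelve. all: by end_near. Qed.

(** Near infinity psi = n phi, so [pick_inequality] for [nu] at iy and 2iy speaks of the expansion
    of [mu]. The combination m 4 - 2 (m 2)^2 is the fourth free cumulant; the term with 1 / n comes
    from the squares of P1 and P2 in F1. *)
Lemma free_power_hankel (nu : law) n : (1 < n)%N -> is_free_power nu n mu -> 0 < m 2 ->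
  0 <= m 2 * (m 4 - 2 * m 2 ^+ 2 + m 2 ^+ 2 / n%:R) - m 3 ^+ 2.
Proof.
move=> n1 np m20.
have n0 : 0 < n%:R :> R by rewrite ltr0n; exact: ltn_trans n1.
have [phi [psi [phiT psiT psiE]]] := free_power_ray_transform_ex n1 np.
have [M ML] := ray_transform_real_expansion psiT.
have ML2 := near_pinfty_double ML.
move: (m 2) (m 3) (m 4 - 2 * m 2 ^+ 2) m20 ML ML2 => k2 k3 k4 k20 ML ML2.
(* p1, p2 and q have finite limits, and the inequality between iy and 2iy is
   F1 F2 + q^2 F3 >= 0 up to a positive factor. *)
pose p1 y := (- Im (psi y) * y - k2) * y ^+ 2.
pose p2 y := (- Im (psi (2 * y)) * y - k2 / 2) * y ^+ 2.
pose q y := (Re (psi y) - Re (psi (2 * y))) * y ^+ 2.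
have x0 : (y : R)^-1 @[y --> +oo] --> (0 : R).
  apply: (@cvg_dist_pinfty _ _ _ 1); near=> y.
  have y0 : 0 < y by near: y; exact: near_pinfty_gt.
  by rewrite subr0 mul1r gtr0_norm// invr_gt0.
have p1l : p1 y @[y --> +oo] --> - k4.
  apply: (@cvg_dist_pinfty _ _ _ M); near=> y.
  have y0 : 0 < y by near: y; exact: near_pinfty_gt.
  have [h _] : `|- Im (psi y) * y - k2 + k4 / y ^+ 2| <= M / y ^+ 3 /\
    `|Re (psi y) - c + k3 / y ^+ 2| <= M / y ^+ 3 by near: y.
  rewrite (_ : p1 y - - k4 = (- Im (psi y) * y - k2 + k4 / y ^+ 2) * y ^+ 2); last first.
    by rewrite /p1; field; rewrite gt_eqF.
  rewrite normrM (gtr0_norm (exprn_gt0 2 y0)) -ler_pdivlMr ?exprn_gt0//.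
  by rewrite (le_trans h)// le_eqVlt; apply/orP; left; apply/eqP; field; rewrite gt_eqF.
have p2l : p2 y @[y --> +oo] --> - k4 / 8.
  apply: (@cvg_dist_pinfty _ _ _ (M / 16)); near=> y.
  have y0 : 0 < y by near: y; exact: near_pinfty_gt.
  have [h _] : `|- Im (psi (2 * y)) * (2 * y) - k2 + k4 / (2 * y) ^+ 2| <= M / (2 * y) ^+ 3 /\
    `|Re (psi (2 * y)) - c + k3 / (2 * y) ^+ 2| <= M / (2 * y) ^+ 3 by near: y.
  rewrite (_ : p2 y - - k4 / 8 =
    (- Im (psi (2 * y)) * (2 * y) - k2 + k4 / (2 * y) ^+ 2) * (y ^+ 2 / 2)); last first.
    by rewrite /p2; field; rewrite gt_eqF.
  have y2 : 0 < y ^+ 2 / 2 by rewrite divr_gt0// exprn_gt0.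
  rewrite normrM (gtr0_norm y2) -ler_pdivlMr//.
  by rewrite (le_trans h)// le_eqVlt; apply/orP; left; apply/eqP; field; rewrite gt_eqF.
have ql : q y @[y --> +oo] --> - (3 / 4 * k3).
  apply: (@cvg_dist_pinfty _ _ _ (9 / 8 * M)); near=> y.
  have y0 : 0 < y by near: y; exact: near_pinfty_gt.
  have [_ h1] : `|- Im (psi y) * y - k2 + k4 / y ^+ 2| <= M / y ^+ 3 /\
    `|Re (psi y) - c + k3 / y ^+ 2| <= M / y ^+ 3 by near: y.
  have [_ h2] : `|- Im (psi (2 * y)) * (2 * y) - k2 + k4 / (2 * y) ^+ 2| <= M / (2 * y) ^+ 3 /\
    `|Re (psi (2 * y)) - c + k3 / (2 * y) ^+ 2| <= M / (2 * y) ^+ 3 by near: y.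
  rewrite (_ : q y - - (3 / 4 * k3) = ((Re (psi y) - c + k3 / y ^+ 2)
    - (Re (psi (2 * y)) - c + k3 / (2 * y) ^+ 2)) * y ^+ 2); last first.
    by rewrite /q; field; rewrite gt_eqF.
  rewrite normrM (gtr0_norm (exprn_gt0 2 y0)) -ler_pdivlMr ?exprn_gt0//.
  apply: (le_trans (ler_normB _ _)); apply: (le_trans (lerD h1 h2)).
  by rewrite le_eqVlt; apply/orP; left; apply/eqP; field; rewrite gt_eqF.
(* P1 and P2 are -y Im psi at y and 2y. In [pick_inequality], r_i = N P_i / y, v_i = y V_i and d = N
   q / y^2. In r1 v1 - r2 v2 the terms k2 cancel, which leaves N F1 / y^2; in r2 v1 - r1 v2 the
   products P1 P2 cancel, which leaves N F2. *)
pose P1 y := k2 + y^-1 * (y^-1 * p1 y).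
pose P2 y := k2 / 2 + y^-1 * (y^-1 * p2 y).
pose N : R := n%:R^-1.
pose V1 y := 1 - N * (y^-1 * (y^-1 * P1 y)).
pose V2 y := 2 - N * (y^-1 * (y^-1 * P2 y)).
pose F1 y := p1 y - 2 * p2 y - N * (P1 y * P1 y) + N * (P2 y * P2 y).
pose F2 y := P2 y - 2 * P1 y.
pose F3 y := N * (N * (y^-1 * (y^-1 * (y^-1 * (y^-1 * (P1 y * P2 y)))))) - V1 y * V2 y.
have cM (f g : R -> R) (a b : R) : f y @[y --> +oo] --> (a : R) -> g y @[y --> +oo] --> b ->
  f y * g y @[y --> +oo] --> a * b by move=> fa gb; exact: cvgM.
have cD (f g : R -> R) (a b : R) : f y @[y --> +oo] --> (a : R) -> g y @[y --> +oo] --> b ->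
  f y + g y @[y --> +oo] --> a + b by move=> fa gb; exact: cvgD.
have cB (f g : R -> R) (a b : R) : f y @[y --> +oo] --> (a : R) -> g y @[y --> +oo] --> b ->
  f y - g y @[y --> +oo] --> a - b by move=> fa gb; exact: cvgB.
have cst (a : R) : (fun _ : R => a) y @[y --> +oo] --> a by exact: cvg_cst.
have P1l := cD _ _ _ _ (cst k2) (cM _ _ _ _ x0 (cM _ _ _ _ x0 p1l)).
have P2l := cD _ _ _ _ (cst (k2 / 2)) (cM _ _ _ _ x0 (cM _ _ _ _ x0 p2l)).
rewrite -/(P1 _) in P1l.
have V1l := cB _ _ _ _ (cst 1) (cM _ _ _ _ (cst N) (cM _ _ _ _ x0 (cM _ _ _ _ x0 P1l))).
have V2l := cB _ _ _ _ (cst 2) (cM _ _ _ _ (cst N) (cM _ _ _ _ x0 (cM _ _ _ _ x0 P2l))).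
have F1l := cD _ _ _ _ (cB _ _ _ _ (cB _ _ _ _ p1l (cM _ _ _ _ (cst 2) p2l))
  (cM _ _ _ _ (cst N) (cM _ _ _ _ P1l P1l))) (cM _ _ _ _ (cst N) (cM _ _ _ _ P2l P2l)).
have F2l := cB _ _ _ _ P2l (cM _ _ _ _ (cst 2) P1l).
have F3l := cB _ _ _ _ (cM _ _ _ _ (cst N) (cM _ _ _ _ (cst N) 
  (cM _ _ _ _ x0 (cM _ _ _ _ x0 (cM _ _ _ _ x0 (cM _ _ _ _ x0
  (cM _ _ _ _ P1l P2l))))))) (cM _ _ _ _ V1l V2l).
have Gl := cD _ _ _ _ (cM _ _ _ _ F1l F2l) (cM _ _ _ _ (cM _ _ _ _ ql ql) F3l).
(* The limit k2 / 2 is positive; this yields the hypothesis 0 < r2 of [pick_inequality]. *)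
have P2p : \forall y \near +oo, 0 < P2 y.
  by apply: (cvgr_gt _ P2l); rewrite !mul0r addr0 divr_gt0.
have ImE (z : C) : Im (n%:R * z) = n%:R * Im z.
  by rewrite -(rmorph_nat (real_complex R)) cImM /= mul0r addr0.
have ReE (z : C) : Re (n%:R * z) = n%:R * Re z.
  by rewrite -(rmorph_nat (real_complex R)) cReM /= mul0r subr0.
have psiE2 := near_pinfty_double psiE.
have [phiT1 _] := phiT; have phiT2 := near_pinfty_double phiT1.
have G0 : \forall y \near +oo, 0 <= F1 y * F2 y + q y * q y * F3 y.
  near=> y.
  have y0 : 0 < y by near: y; exact: near_pinfty_gt.
  have y00 : y != 0 by rewrite gt_eqF.
  have n00 : n%:R != 0 :> R by rewrite gt_eqF.
  have [w1 G1] : 0 < Im (0 +i* y + phi y) /\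
    cauchy_transform nu (0 +i* y + phi y) = (0 +i* y)^-1 by near: y.
  have [w2 G2] : 0 < Im (0 +i* (2 * y) + phi (2 * y)) /\
    cauchy_transform nu (0 +i* (2 * y) + phi (2 * y)) = (0 +i* (2 * y))^-1 by near: y.
  have E1 : psi y = n%:R * phi y by near: y.
  have E2 : psi (2 * y) = n%:R * phi (2 * y) by near: y.
  have P20 : 0 < P2 y by near: y.
  have I1 : Im (phi y) = - (N * P1 y / y).
    by rewrite /N /P1 /p1 E1 ImE; field; rewrite y00 n00.
  have I2 : Im (phi (2 * y)) = - (N * P2 y / y).
    by rewrite /N /P2 /p2 E2 ImE; field; rewrite y00 n00.
  have qE : Re (phi y) - Re (phi (2 * y)) = N * q y / y ^+ 2.
    by rewrite /N /q E1 E2 !ReE; field; rewrite y00 n00.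
  have y20 : 0 < 2 * y by rewrite mulr_gt0.
  have := pick_inequality y0 y20 w1 w2 G1 G2.
  rewrite !cImD !cReD /= !add0r I1 I2 qE opprD !opprK addrA subrr add0r.
  rewrite opprD opprK addrA subrr add0r.
  have r2 : 0 < N * P2 y / y by rewrite divr_gt0// mulr_gt0// invr_gt0.
  move=> /(_ r2).
  set A := (A in is_true (0 <= A) -> _).
  have -> : A = (N / y) ^+ 2 * (F1 y * F2 y + q y * q y * F3 y).
    rewrite /A /F1 /F2 /F3 /V1 /V2 /P1 /P2; field.
    by rewrite y00.
  by rewrite pmulr_rge0// exprn_gt0// divr_gt0// invr_gt0.
have L0 := cvgr_to_ge Gl G0; have {}L0 := L0 proper_pinfty_nbhs.
(* The limits are -3/4 (k4 + k2^2 / n) for F1, -3/2 k2 for F2, -3/4 k3 for q and -2 for F3, whence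
   the common factor 9/8. *)
rewrite -(@pmulr_rge0 _ (9 / 8))//; apply: (le_trans L0).
rewrite le_eqVlt; apply/orP; left; apply/eqP.
by rewrite /N; field; rewrite gt_eqF.
Unshelve. all: by end_near. Qed.

Lemma freely_infinitely_divisible_hankel : freely_infinitely_divisible mu -> 0 < m 2 ->
  0 <= m 2 * (m 4 - 2 * m 2 ^+ 2) - m 3 ^+ 2.
Proof.
move=> fid m20; rewrite leNgt; apply/negP => D0.
set D := _ - _ in D0.
(* [free_power_hankel] reads D + (m 2)^3 / n >= 0, which fails once n > (m 2)^3 / (- D); adding 2
   rather than 1 also ensures n > 1. *)
pose n := (Num.truncn (m 2 ^+ 3 / - D)).+2.
have [nu np] := fid n isT.
have := free_power_hankel (isT : (1 < n)%N) np m20.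
apply/negP; rewrite -ltNge.
have n0 : 0 < n%:R :> R by [].
have -> : m 2 * (m 4 - 2 * m 2 ^+ 2 + m 2 ^+ 2 / n%:R) - m 3 ^+ 2 = D + m 2 ^+ 3 / n%:R.
  by rewrite /D; field; rewrite gt_eqF.
have DN : 0 < - D by rewrite oppr_gt0.
rewrite -ltrBrDl sub0r ltr_pdivrMr// mulrC -ltr_pdivrMr//.
apply: lt_trans (_ : _ < (Num.truncn (m 2 ^+ 3 / - D)).+1%:R) _; last by rewrite ltr_nat.
by apply: truncnS_gt.
Qed.

End free_divisibility.

(** * From central moments to D1 *)

Section D1_nonnegative.
Context {R : realType}.
Local Open Scope classical_set_scope.
Variables (mu : probability (measurableTypeR R) R) (K : R).
Hypothesis muK : {ae mu, forall t, `|t| <= K}.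

Let integrable_pow n : mu.-integrable setT (EFin \o (fun t : R => t ^+ n)).
Proof.
apply: (@integrable_bounded _ _ _ (`|K| ^+ n)); first exact: measurable_funX.
apply: (@filterS _ _ (ae_filter_ringOfSetsType mu) _ _ _ muK) => t H.
by rewrite normrX lerXn2r ?nnegrE// (le_trans H) ?ler_norm.
Qed.

Lemma central_moments : let c := moment mu 1 in
  [/\ \int[mu]_t (t - c) = 0,
      \int[mu]_t (t - c) ^+ 2 = moment mu 2 - c ^+ 2,
      \int[mu]_t (t - c) ^+ 3 = moment mu 3 - 3 * c * moment mu 2 + 2 * c ^+ 3
    & \int[mu]_t (t - c) ^+ 4 =
      moment mu 4 - 4 * c * moment mu 3 + 6 * c ^+ 2 * moment mu 2 - 3 * c ^+ 4].
Proof.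
move=> c.
have m0 : \int[mu]_t (t ^+ 0) = 1.
  by under eq_Rintegral do rewrite expr0;
    rewrite Rintegral_cst// [X in fine X]probability_setT mulr1.
split.
- have [_ E] := integrable_lin 1 (- c) (integrable_pow 1) (integrable_pow 0).
  transitivity (\int[mu]_t (1 * t ^+ 1 + - c * t ^+ 0));
    first by apply: eq_Rintegral => t _; ring.
  by rewrite E m0 -/(moment mu 1) -/c; ring.
- have [I1 E1] := integrable_lin (- 2 * c) (c ^+ 2) (integrable_pow 1) (integrable_pow 0).
  have [_ E] := integrable_lin 1 1 (integrable_pow 2) I1.
  transitivity (\int[mu]_t (1 * t ^+ 2 + 1 * (- 2 * c * t ^+ 1 + c ^+ 2 * t ^+ 0)));
    first by apply: eq_Rintegral => t _; ring.
  by rewrite E E1 m0 -!/(moment mu _) -/c; ring.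
- have [I1 E1] := integrable_lin (3 * c ^+ 2) (- c ^+ 3) (integrable_pow 1) (integrable_pow 0).
  have [I2 E2] := integrable_lin (- 3 * c) 1 (integrable_pow 2) I1.
  have [_ E] := integrable_lin 1 1 (integrable_pow 3) I2.
  transitivity (\int[mu]_t (1 * t ^+ 3 +
    1 * (- 3 * c * t ^+ 2 + 1 * (3 * c ^+ 2 * t ^+ 1 + - c ^+ 3 * t ^+ 0))));
    first by apply: eq_Rintegral => t _; ring.
  by rewrite E E2 E1 m0 -!/(moment mu _) -/c; ring.
- have [I1 E1] := integrable_lin (- 4 * c ^+ 3) (c ^+ 4) (integrable_pow 1) (integrable_pow 0).
  have [I2 E2] := integrable_lin (6 * c ^+ 2) 1 (integrable_pow 2) I1.
  have [I3 E3] := integrable_lin (- 4 * c) 1 (integrable_pow 3) I2.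
  have [_ E] := integrable_lin 1 1 (integrable_pow 4) I3.
  transitivity (\int[mu]_t (1 * t ^+ 4 +
    1 * (- 4 * c * t ^+ 3 + 1 * (6 * c ^+ 2 * t ^+ 2 +
      1 * (- 4 * c ^+ 3 * t ^+ 1 + c ^+ 4 * t ^+ 0)))));
    first by apply: eq_Rintegral => t _; ring.
  by rewrite E E3 E2 E1 m0 -!/(moment mu _) -/c; ring.
Qed.

(** Free cumulants of order at least 2 are invariant under translation, so D1 is the centered
    expression bounded in [freely_infinitely_divisible_hankel]. *)
Lemma freely_infinitely_divisible_D1_ge0 : freely_infinitely_divisible mu ->
  0 < moment mu 2 - moment mu 1 ^+ 2 -> 0 <= D1 mu.
Proof.
move=> fid; have [mean c2 c3 c4] := central_moments.
set c := moment mu 1 in mean c2 c3 c4 *; rewrite -c2 => var.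
have K'0 : 0 <= `|K| + `|c| by [].
have muK' : {ae mu, forall t, `|t - c| <= `|K| + `|c|}.
  apply: (@filterS _ _ (ae_filter_ringOfSetsType mu) _ _ _ muK) => t H.
  by rewrite (le_trans (ler_normB _ _))// lerD2r (le_trans H)// ler_norm.
have := freely_infinitely_divisible_hankel K'0 muK' mean fid var.
rewrite /D1; have [-> -> ->] := free_cumulantsE mu.
rewrite c2 c3 c4 -/c; congr (0 <= _); ring.
Qed.

End D1_nonnegative.

Theorem theorem3p1 (R : realType) (p q : R) (hp : 0 < p) (hq : 0 < q) :
  let s := p + q in
  D1 (beta_law hp hq) =
    p ^+ 2 * q ^+ 2 * Psi p q
      / (s ^+ 6 * (s + 1) ^+ 3 * (s + 2) ^+ 2 * (s + 3))
  /\ (Psi p q < 0 -> ~ freely_infinitely_divisible (beta_law hp hq)).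
Proof.
move=> s; set mu := beta_law hp hq.
have s0 : 0 < s by rewrite addr_gt0.
have sn n : s + n%:R != 0 by rewrite gt_eqF// ltr_wpDr.
have s00 : s != 0 by rewrite gt_eqF.
have m0 : moment mu 0 = 1 by exact: moment_beta_law0.
have m1 : moment mu 1 = p / s by rewrite moment_beta_lawS m0 !addr0 mulr1.
have m2 : moment mu 2 = (p + 1) / (s + 1) * (p / s) by rewrite moment_beta_lawS m1.
have m3 : moment mu 3 = (p + 2) / (s + 2) * ((p + 1) / (s + 1) * (p / s)).
  by rewrite moment_beta_lawS m2.
have m4 : moment mu 4 =
    (p + 3) / (s + 3) * ((p + 2) / (s + 2) * ((p + 1) / (s + 1) * (p / s))).
  by rewrite moment_beta_lawS m3.
(* Eliminating q leaves s and p as the only atoms, so that [field] meets just the denominators s +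
   n. *)
have sq : q = s - p by rewrite /s addrC addKr.
have D1E : D1 mu = p ^+ 2 * q ^+ 2 * Psi p q
      / (s ^+ 6 * (s + 1) ^+ 3 * (s + 2) ^+ 2 * (s + 3)).
  rewrite /D1; have [-> -> ->] := free_cumulantsE mu.
  rewrite m1 m2 m3 m4 /Psi -/s sq; field.
  by rewrite s00 (sn 1%N) (sn 2%N) (sn 3%N).
split=> // Psi0 fid.
have muK : {ae mu, forall t, `|t| <= (1 : R)}.
  exists (~` `]0%R, 1%R[)%classic; split.
  - by apply: measurableC; exact: measurable_itv.
  - exact: beta_law_itvC.
  move=> t /= H; rewrite in_itv/= => /andP[t0 t1]; apply: H.
  by rewrite gtr0_norm// ltW.
have var : 0 < moment mu 2 - moment mu 1 ^+ 2.
  rewrite m1 m2 (_ : _ - _ = p * q / (s ^+ 2 * (s + 1))).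
    by rewrite divr_gt0 ?mulr_gt0 ?exprn_gt0// addr_gt0.
  by rewrite sq; field; rewrite s00 (sn 1%N).
have := freely_infinitely_divisible_D1_ge0 muK fid var.
rewrite leNgt => /negP; apply; rewrite D1E -mulrA pmulr_rlt0 ?mulr_gt0 ?exprn_gt0//.
by rewrite pmulr_llt0// invr_gt0 !mulr_gt0 ?exprn_gt0// addr_gt0.
Qed.
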